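(* Let $c_0\neq 0$ be a real number, let $\mathfrak{h}\in C^1([-1,1])$, and let $\mathcal{H}\in C^1(\mathbb{S}^2)$ be the rotationally symmetric function $\mathcal{H}(x)=\mathfrak{h}(\langle x,e_3\rangle)$. Then, up to rotations around the $e_3$-axis, there exists at most one helicoidal $\mathcal{H}$-surface in $\mathbb{R}^3$ (with rotation axis the $e_3$-axis and pitch $c_0$) that intersects its rotation axis.
   Context: An immersed, oriented surface $\Sigma$ in $\mathbb{R}^3$ with Gauss map $\eta:\Sigma\to\mathbb{S}^2$ is an $\mathcal{H}$-surface (surface of prescribed mean curvature $\mathcal{H}$), for a given $\mathcal{H}\in C^1(\mathbb{S}^2)$, if its mean curvature satisfies $H_\Sigma=\mathcal{H}\circ\eta$. Here $H_\Sigma=\frac{eG-2fF+gE}{2(EG-F^2)}$, where $E,F,G$ and $e,f,g$ are the coefficients of the first and second fundamental forms with respect to $\eta$ (so $H_\Sigma$ is the average of the principal curvatures). A helicoidal surface with rotation axis the $e_3$-axis and pitch $c_0\neq 0$ is an immersed, oriented surface obtained as the orbit of a regular planar curve parametrized by arc-length $\alpha(s)=(x(s),0,z(s))$, $s\in I\subset\mathbb{R}$ (the profile curve), under a helicoidal motion, i.e. it is parametrized by $$\Psi(s,\theta)=(x(s)\cos\theta,\;x(s)\sin\theta,\;z(s)+c_0\theta),\qquad (s,\theta)\in I\times\mathbb{R}.$$ It is assumed that $x'(s)\neq 0$ whenever $x(s)=0$, so that $\Psi$ is an immersion. Up to a change of orientation the Gauss map is $$\eta(s,\theta)=\frac{\left(c_0\sin\theta\,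 x'-\cos\theta\, z'x,\;-\sin\theta\, x z'-c_0\cos\theta\, x',\;x x'\right)}{\sqrt{c_0^2x'^2+x^2}}.$$ Here $e_3=(0,0,1)$ and the $e_3$-axis is the line $\{(0,0,t):t\in\mathbb{R}\}$. Surfaces are regarded as subsets of $\mathbb{R}^3$ and are taken to be inextendible (not a proper piece of a larger helicoidal $\mathcal{H}$-surface with the same axis and pitch). *)

(* Defs.v *)
From Stdlib Require Import Reals.
From Coquelicot Require Import Coquelicot.
Open Scope R_scope.

Definition R3 : Type := (R * R * R)%type.

Definition crd1 (p : R3) : R := fst (fst p).
Definition crd2 (p : R3) : R := snd (fst p).
Definition crd3 (p : R3) : R := snd p.

Definition dot (u v : R3) : R :=
  crd1 u * crd1 v + crd2 u * crd2 v + crd3 u * crd3 v.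

Definition e3 : R3 := (0, 0, 1).

Definition rot_e3 (phi : R) (p : R3) : R3 :=
  (cos phi * crd1 p - sin phi * crd2 p,
   sin phi * crd1 p + cos phi * crd2 p,
   crd3 p).

(* h is of class C^1 on [-1,1], with one-sided derivatives at the endpoints;
   values of h outside [-1,1] are irrelevant. *)
Definition C1_m1_1 (h : R -> R) : Prop :=
  exists dh : R -> R, forall t, -1 <= t <= 1 ->
    D_in h dh (fun u => -1 <= u <= 1) t /\
    continue_in dh (fun u => -1 <= u <= 1) t.

Definition C2_on (I : R -> Prop) (f : R -> R) : Prop :=
  forall s, I s ->
    ex_derive f s /\ ex_derive (Derive f) s /\ continuous (Derive (Derive f)) s.

Definition open_interval (I : R -> Prop) : Prop :=
  open I /\ (exists s, I s) /\
  (forall a b c, I a -> I c -> a <= b <= c -> I b).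

Definition Derive_R3 (f : R -> R3) (t : R) : R3 :=
  (Derive (fun u => crd1 (f u)) t,
   Derive (fun u => crd2 (f u)) t,
   Derive (fun u => crd3 (f u)) t).

Definition pd1 (P : R -> R -> R3) (s t : R) : R3 := Derive_R3 (fun u => P u t) s.
Definition pd2 (P : R -> R -> R3) (s t : R) : R3 := Derive_R3 (fun u => P s u) t.

(* An orientation of the surface parametrized by P on D is a continuous unit
   normal field along P. *)
Definition gauss_map (D : R -> R -> Prop) (P eta : R -> R -> R3) : Prop :=
  forall s t, D s t ->
    continuous (fun q : R * R => eta (fst q) (snd q)) (s, t) /\
    dot (eta s t) (eta s t) = 1 /\
    dot (eta s t) (pd1 P s t) = 0 /\
    dot (eta s t) (pd2 P s t) = 0.

Definition mean_curvature (P eta : R -> R -> R3) (s t : R) : R :=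
  let E := dot (pd1 P s t) (pd1 P s t) in
  let F := dot (pd1 P s t) (pd2 P s t) in
  let G := dot (pd2 P s t) (pd2 P s t) in
  let e := dot (pd1 (pd1 P) s t) (eta s t) in
  let f := dot (pd2 (pd1 P) s t) (eta s t) in
  let g := dot (pd2 (pd2 P) s t) (eta s t) in
  (e * G - 2 * f * F + g * E) / (2 * (E * G - F ^ 2)).

Definition helicoidal_param (c0 : R) (x z : R -> R) (s theta : R) : R3 :=
  (x s * cos theta, x s * sin theta, z s + c0 * theta).

(* The last clause makes helicoidal_param an immersion when c0 <> 0. *)
Definition profile_curve (I : R -> Prop) (x z : R -> R) : Prop :=
  C2_on I x /\ C2_on I z /\
  (forall s, I s -> Derive x s ^ 2 + Derive z s ^ 2 = 1) /\
  (forall s, I s -> x s = 0 -> Derive x s <> 0).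

(* The set Sigma is a helicoidal surface around the e3-axis with pitch c0 which,
   for one of its orientations, has prescribed mean curvature H; only the values
   of H on the unit sphere matter. *)
Definition helicoidal_H_surface (H : R3 -> R) (c0 : R) (Sigma : R3 -> Prop) : Prop :=
  exists (I : R -> Prop) (x z : R -> R) (eta : R -> R -> R3),
    open_interval I /\
    profile_curve I x z /\
    gauss_map (fun s _ => I s) (helicoidal_param c0 x z) eta /\
    (forall s theta, I s ->
       mean_curvature (helicoidal_param c0 x z) eta s theta = H (eta s theta)) /\
    (forall p, Sigma p <->
       exists s theta, I s /\ p = helicoidal_param c0 x z s theta).

Definition inextendible (H : R3 -> R) (c0 : R) (Sigma : R3 -> Prop) : Prop :=
  forall Sigma' : R3 -> Prop,
    helicoidal_H_surface H c0 Sigma' ->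
    (forall p, Sigma p -> Sigma' p) ->
    forall p, Sigma' p -> Sigma p.

Definition meets_axis (Sigma : R3 -> Prop) : Prop :=
  exists t : R, Sigma (0, 0, t).

(* Main.v *)
Require Import Defs.
From Stdlib Require Import Reals Lra Psatz Classical ClassicalEpsilon.
From Coquelicot Require Import Coquelicot.
Open Scope R_scope.

(** A helicoidal surface is determined by its profile curve, and the equation of
    prescribed mean curvature is an ordinary differential equation for this
    curve, singular exactly where the curve meets the axis. There the singular
    term has to vanish, and this determines the direction in which the profile
    crosses the axis ([tilt_on_axis], [initial_direction]). The crossing height
    is immaterial, because a vertical translation of the profile has the same
    effect as a rotation of the surface ([rot_helicoidal]), and so are the
    orientation of the profile and the side of the axis towards which it leaves
    ([normal_form]). Two surfaces that meet the axis can therefore be generated by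
    profiles that start with the same position and the same direction.

    It remains to see that these initial data determine the solution. Away from
    the axis this is the Lipschitz uniqueness theorem ([flow_unique_off_axis]).
    On the axis, let [u = x'], [v = z'] and [w = v / sqrt (c0^2 u^2 + x^2)]; the
    equation becomes [x w' = 2 u (h - w)], where [h] is taken at the vertical
    component of the normal. The singular term [-2 u w / x] is dissipative, on
    both sides of the crossing, and after the blow-up [y = x / (s - s0)] it beats
    all other terms: a weighted sum of the squares of the differences of [y] and
    of [w] does not increase away from the crossing, where it vanishes
    ([flow_unique_on_axis]).

    By connectedness the two profiles agree on the intersection of their domains
    ([solutions_agree]), so they are restrictions of a single solution on the
    union ([solution_glue]). The surface which it generates contains both given
    surfaces, up to a rotation, and inextendibility makes these inclusions
    equalities. *)

(** * Comparison of functions along a filter *)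

(** Two functions with the same limit whose difference is at most a constant
    times [D]. Carrying the limit along with the Lipschitz bound makes the
    relation stable under all the operations by which the curvature of a
    profile curve is computed from the curve, with no explicit constants. [D]
    will be a distance between two profile curves. *)
Definition lip_close (F : (R -> Prop) -> Prop) (D : R -> R) (l : R) (a b : R -> R) : Prop :=
  filterlim a F (locally l) /\ filterlim b F (locally l) /\
  exists L, 0 <= L /\ F (fun s => Rabs (a s - b s) <= L * D s).

Lemma lim_near (F : (R -> Prop) -> Prop) (a : R -> R) (l : R) :
  filterlim a F (locally l) ->
  forall e, 0 < e -> F (fun s => Rabs (a s - l) < e).
Proof.
  intros Ha e He.
  apply (Ha (fun y => Rabs (y - l) < e)).
  exists (mkposreal e He). intros y Hy. exact Hy.
Qed.

Lemma lim_of_near (F : (R -> Prop) -> Prop) {FF : Filter F} (a : R -> R) (l : R) :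
  (forall e, 0 < e -> F (fun s => Rabs (a s - l) < e)) ->
  filterlim a F (locally l).
Proof.
  intros H P [e He]. unfold filtermap.
  apply filter_imp with (2 := H e (cond_pos e)).
  intros s Hs. apply He. exact Hs.
Qed.

Section Close.

Variable F : (R -> Prop) -> Prop.
Context {FF : Filter F}.
Variable D : R -> R.

Lemma lip_refl l a : filterlim a F (locally l) -> lip_close F D l a a.
Proof.
  intros Ha. split; [|split]; auto.
  exists 0. split; [lra|]. apply filter_forall. intros s.
  rewrite Rminus_diag, Rabs_R0. lra.
Qed.

Lemma lip_const c : lip_close F D c (fun _ => c) (fun _ => c).
Proof. apply lip_refl. apply filterlim_const. Qed.

Lemma lip_ext l a b a' b' :
  F (fun s => a s = a' s) -> F (fun s => b s = b' s) ->
  lip_close F D l a b -> lip_close F D l a' b'.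
Proof.
  intros Ha Hb (H1 & H2 & L & HL & H3). split; [|split].
  - apply filterlim_ext_loc with (2 := H1). exact Ha.
  - apply filterlim_ext_loc with (2 := H2). exact Hb.
  - exists L. split; auto.
    generalize (filter_and _ _ Ha (filter_and _ _ Hb H3)).
    apply filter_imp. intros s (E1 & E2 & E3). rewrite <- E1, <- E2. exact E3.
Qed.

Lemma lip_plus l m a b c d :
  lip_close F D l a b -> lip_close F D m c d ->
  lip_close F D (l + m) (fun s => a s + c s) (fun s => b s + d s).
Proof.
  intros (H1 & H2 & L & HL & H3) (G1 & G2 & M & HM & G3). split; [|split].
  - apply filterlim_comp_2 with (1 := H1) (2 := G1). apply (filterlim_plus l m).
  - apply filterlim_comp_2 with (1 := H2) (2 := G2). apply (filterlim_plus l m).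
  - exists (L + M). split; [lra|].
    generalize (filter_and _ _ H3 G3). apply filter_imp. intros s (E1 & E2).
    replace (a s + c s - (b s + d s)) with ((a s - b s) + (c s - d s)) by ring.
    eapply Rle_trans; [apply Rabs_triang|]. lra.
Qed.

Lemma lim_bounded a l :
  filterlim a F (locally l) -> F (fun s => Rabs (a s) <= Rabs l + 1).
Proof.
  intros H. generalize (lim_near _ _ _ H 1 Rlt_0_1). apply filter_imp.
  intros s Hs. replace (a s) with ((a s - l) + l) by ring.
  eapply Rle_trans; [apply Rabs_triang|]. lra.
Qed.

Lemma lim_away a l :
  filterlim a F (locally l) -> l <> 0 -> F (fun s => Rabs l / 2 <= Rabs (a s)).
Proof.
  intros H Hl. assert (0 < Rabs l) by (apply Rabs_pos_lt; auto).
  generalize (lim_near _ _ _ H (Rabs l / 2) ltac:(lra)). apply filter_imp.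
  intros s Hs.
  assert (Rabs l <= Rabs (a s - l) + Rabs (a s)); [|lra].
  replace l with (- (a s - l) + a s) at 1 by ring.
  eapply Rle_trans; [apply Rabs_triang|]. rewrite Rabs_Ropp. lra.
Qed.

Lemma lip_mult l m a b c d :
  lip_close F D l a b -> lip_close F D m c d ->
  lip_close F D (l * m) (fun s => a s * c s) (fun s => b s * d s).
Proof.
  intros (H1 & H2 & L & HL & H3) (G1 & G2 & M & HM & G3). split; [|split].
  - apply filterlim_comp_2 with (1 := H1) (2 := G1). apply (filterlim_mult l m).
  - apply filterlim_comp_2 with (1 := H2) (2 := G2). apply (filterlim_mult l m).
  - pose proof (Rabs_pos l). pose proof (Rabs_pos m).
    exists (L * (Rabs m + 1) + (Rabs l + 1) * M). split; [nra|].
    generalize (filter_and _ _ (filter_and _ _ H3 G3)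
      (filter_and _ _ (lim_bounded _ _ H2) (lim_bounded _ _ G1))).
    apply filter_imp. intros s ((E1 & E2) & E3 & E4).
    replace (a s * c s - b s * d s) with ((a s - b s) * c s + b s * (c s - d s)) by ring.
    eapply Rle_trans; [apply Rabs_triang|]. rewrite !Rabs_mult.
    pose proof (Rabs_pos (a s - b s)). pose proof (Rabs_pos (c s - d s)).
    pose proof (Rabs_pos (b s)). pose proof (Rabs_pos (c s)).
    assert (Rabs (a s - b s) * Rabs (c s) <= L * D s * (Rabs m + 1))
      by (apply Rmult_le_compat; auto).
    assert (Rabs (b s) * Rabs (c s - d s) <= (Rabs l + 1) * (M * D s))
      by (apply Rmult_le_compat; auto).
    lra.
Qed.

Lemma lip_opp l a b : lip_close F D l a b -> lip_close F D (- l) (fun s => - a s) (fun s => - b s).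
Proof.
  intros H. replace (- l) with ((-1) * l) by ring.
  apply lip_ext with (3 := lip_mult _ _ _ _ _ _ (lip_const (-1)) H);
    apply filter_forall; intros; ring.
Qed.

Lemma lip_minus l m a b c d :
  lip_close F D l a b -> lip_close F D m c d ->
  lip_close F D (l - m) (fun s => a s - c s) (fun s => b s - d s).
Proof. intros H G. apply lip_plus; [exact H|]. apply lip_opp. exact G. Qed.

Lemma lip_sqr l a b : lip_close F D l a b -> lip_close F D (l ^ 2) (fun s => a s ^ 2) (fun s => b s ^ 2).
Proof.
  intros H. replace (l ^ 2) with (l * l) by ring.
  apply lip_ext with (3 := lip_mult _ _ _ _ _ _ H H);
    apply filter_forall; intros; ring.
Qed.

Lemma lip_inv l a b :
  l <> 0 -> lip_close F D l a b -> lip_close F D (/ l) (fun s => / a s) (fun s => / b s).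
Proof.
  intros Hl (H1 & H2 & L & HL & H3).
  assert (Hp : 0 < Rabs l) by (apply Rabs_pos_lt; auto).
  assert (Hc : filterlim Rinv (locally l) (locally (/ l))).
  { apply (filterlim_Rbar_inv l). intros K. apply Hl. inversion K; auto. }
  split; [|split].
  - apply filterlim_comp with (1 := H1) (2 := Hc).
  - apply filterlim_comp with (1 := H2) (2 := Hc).
  - exists (L * (/ (Rabs l / 2) * / (Rabs l / 2))). 
    assert (0 < / (Rabs l / 2)) by (apply Rinv_0_lt_compat; lra).
    split; [apply Rmult_le_pos; nra|].
    generalize (filter_and _ _ H3 (filter_and _ _ (lim_away _ _ H1 Hl) (lim_away _ _ H2 Hl))).
    apply filter_imp. intros s (E1 & E2 & E3).
    assert (a s <> 0) by (intros K; rewrite K, Rabs_R0 in E2; lra).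
    assert (b s <> 0) by (intros K; rewrite K, Rabs_R0 in E3; lra).
    replace (/ a s - / b s) with (- (a s - b s) * (/ a s * / b s)) by (field; auto).
    rewrite !Rabs_mult, Rabs_Ropp, !Rabs_inv.
    assert (0 < / Rabs (a s) <= / (Rabs l / 2)).
    { split; [apply Rinv_0_lt_compat; lra|]. apply Rinv_le_contravar; lra. }
    assert (0 < / Rabs (b s) <= / (Rabs l / 2)).
    { split; [apply Rinv_0_lt_compat; lra|]. apply Rinv_le_contravar; lra. }
    replace (L * (/ (Rabs l / 2) * / (Rabs l / 2)) * D s) with
      (L * D s * (/ (Rabs l / 2) * / (Rabs l / 2))) by ring.
    apply Rmult_le_compat; auto using Rabs_pos; [nra|].
    apply Rmult_le_compat; lra.
Qed.

Lemma lip_div l m a b c d :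
  m <> 0 -> lip_close F D l a b -> lip_close F D m c d ->
  lip_close F D (l / m) (fun s => a s / c s) (fun s => b s / d s).
Proof. intros Hm H G. apply lip_mult; auto. apply lip_inv; auto. Qed.

(** The difference of the squares is the difference of the functions times a
    sum that stays away from zero. This avoids choosing the sign of a square root. *)
Lemma lip_of_sqr l m a b :
  l <> 0 -> filterlim a F (locally l) -> filterlim b F (locally l) ->
  lip_close F D m (fun s => a s ^ 2) (fun s => b s ^ 2) -> lip_close F D l a b.
Proof.
  intros Hl H1 H2 (_ & _ & L & HL & H3). split; [|split]; auto.
  assert (Hp : 0 < Rabs l) by (apply Rabs_pos_lt; auto).
  assert (H4 : filterlim (fun s => a s + b s) F (locally (l + l))).
  { apply filterlim_comp_2 with (1 := H1) (2 := H2). apply (filterlim_plus l l). }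
  assert (Hl2 : l + l <> 0) by lra.
  assert (Hq : Rabs (l + l) / 2 = Rabs l).
  { replace (l + l) with (2 * l) by ring. rewrite Rabs_mult, (Rabs_right 2); lra. }
  exists (L * / Rabs l).
  assert (0 < / Rabs l) by (apply Rinv_0_lt_compat; auto).
  split; [nra|].
  generalize (filter_and _ _ H3 (lim_away _ _ H4 Hl2)). rewrite Hq.
  apply filter_imp. intros s (E1 & E2).
  replace (a s ^ 2 - b s ^ 2) with ((a s - b s) * (a s + b s)) in E1 by ring.
  rewrite Rabs_mult in E1. pose proof (Rabs_pos (a s - b s)).
  apply Rmult_le_reg_r with (1 := Hp).
  replace (L * / Rabs l * D s * Rabs l) with (L * D s) by (field; lra).
  eapply Rle_trans; [|exact E1]. apply Rmult_le_compat_l; auto.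
Qed.

Lemma lip_sqrt l a b :
  0 < l -> lip_close F D l a b -> lip_close F D (sqrt l) (fun s => sqrt (a s)) (fun s => sqrt (b s)).
Proof.
  intros Hl H. destruct H as (H1 & H2 & H3).
  assert (Hs : filterlim sqrt (locally l) (locally (sqrt l))).
  { apply continuity_pt_filterlim. apply continuity_pt_sqrt. lra. }
  assert (P : forall c, filterlim c F (locally l) -> F (fun s => c s = sqrt (c s) ^ 2)).
  { intros c Hc. generalize (lim_near _ _ _ Hc l Hl). apply filter_imp.
    intros s Es. apply Rabs_def2 in Es. rewrite pow2_sqrt; lra. }
  apply lip_of_sqr with l.
  - apply Rgt_not_eq. apply sqrt_lt_R0. exact Hl.
  - apply filterlim_comp with (1 := H1) (2 := Hs).
  - apply filterlim_comp with (1 := H2) (2 := Hs).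
  - apply lip_ext with a b; auto. split; auto.
Qed.

Lemma lip_comp h l a b :
  (exists L, 0 <= L /\ exists d, 0 < d /\ forall p q, Rabs (p - l) < d -> Rabs (q - l) < d ->
      Rabs (h p - h q) <= L * Rabs (p - q)) ->
  lip_close F D l a b -> lip_close F D (h l) (fun s => h (a s)) (fun s => h (b s)).
Proof.
  intros (L & HL & d & Hd & Hh) (H1 & H2 & M & HM & H3).
  assert (Hc : filterlim h (locally l) (locally (h l))).
  { apply lim_of_near; [apply locally_filter|]. intros e He.
    assert (Hm : 0 < Rmin d (e / (L + 1))).
    { apply Rmin_glb_lt; auto. apply Rdiv_lt_0_compat; lra. }
    exists (mkposreal _ Hm). intros y Hy.
    change (Rabs (y - l) < Rmin d (e / (L + 1))) in Hy.
    assert (Y1 := Rlt_le_trans _ _ _ Hy (Rmin_l _ _)).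
    assert (Y2 := Rlt_le_trans _ _ _ Hy (Rmin_r _ _)).
    eapply Rle_lt_trans; [apply Hh; auto|].
    { rewrite Rminus_diag, Rabs_R0. auto. }
    assert (Rabs (y - l) * (L + 1) < e).
    { apply Rmult_lt_reg_r with (/ (L + 1)). apply Rinv_0_lt_compat; lra.
      rewrite Rmult_assoc, Rinv_r, Rmult_1_r by lra. exact Y2. }
    pose proof (Rabs_pos (y - l)). nra. }
  split; [|split].
  - apply filterlim_comp with (1 := H1) (2 := Hc).
  - apply filterlim_comp with (1 := H2) (2 := Hc).
  - exists (L * M). split; [nra|].
    generalize (filter_and _ _ H3 (filter_and _ _ (lim_near _ _ _ H1 d Hd) (lim_near _ _ _ H2 d Hd))).
    apply filter_imp. intros s (E1 & E2 & E3).
    eapply Rle_trans; [apply Hh; auto|]. nra.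
Qed.

End Close.

Lemma lip_mono (F : (R -> Prop) -> Prop) {FF : Filter F} (D D' : R -> R) l a b :
  F (fun s => D s <= D' s) -> lip_close F D l a b -> lip_close F D' l a b.
Proof.
  intros HD (H1 & H2 & L & HL & H3). split; [|split]; auto.
  exists L. split; auto. generalize (filter_and _ _ HD H3).
  apply filter_imp. intros s (E1 & E2). nra.
Qed.

(** * Gronwall lemma, Lipschitz bounds, induction on a segment *)

Lemma locally_intro (P : R -> Prop) (s0 d : R) :
  0 < d -> (forall s, Rabs (s - s0) < d -> P s) -> locally s0 P.
Proof. intros Hd H. exists (mkposreal d Hd). intros y Hy. apply H. exact Hy. Qed.

Lemma locally_elim (P : R -> Prop) (s0 : R) :
  locally s0 P -> exists d, 0 < d /\ forall s, Rabs (s - s0) < d -> P s.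
Proof.
  intros [d H]. exists d. split; [apply cond_pos|]. intros s Hs. apply H. exact Hs.
Qed.

(** The factor [exp (- C * t)] turns [E] into a nonincreasing function, whose
    values are thus bounded by its limit at [0], which is zero. *)
Lemma gronwall_right (E : R -> R) (C d : R) :
  0 < d -> 
  (forall t, 0 < t < d -> 0 <= E t /\ exists E' : R, is_derive E t E' /\ t * E' <= C * t * E t) ->
  (forall e, 0 < e -> exists d', 0 < d' /\ forall t, 0 < t < d' -> E t < e) ->
  forall t, 0 < t < d -> E t = 0.
Proof.
  intros Hd HE Hlim t Ht.
  destruct (HE t Ht) as [Hpos _].
  destruct (Rle_lt_or_eq_dec _ _ Hpos) as [K|K]; [exfalso|auto].
  set (G := fun y => E y * exp (- C * y)).
  assert (HG : forall y, 0 < y < d -> exists G', is_derive G y G' /\ G' <= 0).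
  { intros y Hy. destruct (HE y Hy) as [_ [E' [D1 D2]]].
    exists (E' * exp (- C * y) + E y * (- C * exp (- C * y))). split.
    - apply (is_derive_mult E (fun y => exp (- C * y)) y E' (- C * exp (- C * y))); auto.
      + auto_derive; auto. ring.
      + intros; apply Rmult_comm.
    - assert (E' <= C * E y). { apply Rmult_le_reg_l with y; lra. }
      pose proof (exp_pos (- C * y)). nra. }
  assert (Hdec : forall a, 0 < a < t -> G t <= G a).
  { intros a Ha.
    destruct (MVT_gen G a t (Derive G)) as [c [Hc1 Hc2]].
    - rewrite Rmin_left, Rmax_right by lra. intros y Hy.
      destruct (HG y ltac:(lra)) as [G' [K1 K2]]. rewrite (is_derive_unique _ _ _ K1). auto.
    - rewrite Rmin_left, Rmax_right by lra. intros y Hy.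
      destruct (HG y ltac:(lra)) as [G' [K1 K2]].
      apply continuity_pt_filterlim. apply (ex_derive_continuous G y). exists G'; auto.
    - rewrite Rmin_left, Rmax_right in Hc1 by lra.
      destruct (HG c ltac:(lra)) as [G' [K1 K2]]. rewrite (is_derive_unique _ _ _ K1) in Hc2. nra. }
  (* [m] and [/ m] bound the exponential factor on the whole interval. *)
  set (m := exp (- Rabs C * d)).
  assert (Hm : forall y, 0 < y < d -> m <= exp (- C * y) <= / m).
  { intros y Hy. unfold m. rewrite <- exp_Ropp. pose proof (Rle_abs C). pose proof (Rle_abs (- C)).
    rewrite Rabs_Ropp in H0. pose proof (Rabs_pos C).
    assert (exp_le : forall a b, a <= b -> exp a <= exp b).
    { intros a b [H2|H2]; [left; apply exp_increasing; auto | right; f_equal; auto]. }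
    split; apply exp_le; nra. }
  assert (Hmp : 0 < m) by apply exp_pos.
  destruct (Hlim (E t * m * m)) as [d' [Hd' Hl]].
  { apply Rmult_lt_0_compat; [apply Rmult_lt_0_compat|]; auto. }
  set (a := Rmin d' t / 2).
  assert (0 < Rmin d' t) by (apply Rmin_glb_lt; lra).
  pose proof (Rmin_l d' t). pose proof (Rmin_r d' t).
  assert (Ha : 0 < a < t) by (unfold a; lra).
  assert (Ha' : 0 < a < d') by (unfold a; lra).
  specialize (Hl a Ha'). specialize (Hdec a Ha). unfold G in Hdec.
  pose proof (Hm t ltac:(lra)). pose proof (Hm a ltac:(lra)).
  destruct (HE a ltac:(lra)) as [Ea _].
  assert (E t * m <= E a * / m).
  { apply Rle_trans with (E t * exp (- C * t)). apply Rmult_le_compat_l; lra.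
    eapply Rle_trans; [exact Hdec|]. apply Rmult_le_compat_l; lra. }
  assert (E t * m * m <= E a).
  { replace (E a) with (E a * / m * m) by (field; lra). apply Rmult_le_compat_r; lra. }
  lra.
Qed.

(** The point [s0] itself is excluded, so that [E] may contain quotients by
    [s - s0]. The factor [s - s0] in front of the
    derivative gives the inequality the right sign on both sides. *)
Lemma gronwall (E : R -> R) (C s0 : R) :
  locally' s0 (fun s => 0 <= E s) ->
  locally' s0 (fun s => exists E' : R, is_derive E s E' /\
                          (s - s0) * E' <= C * Rabs (s - s0) * E s) ->
  filterlim E (locally' s0) (locally 0) ->
  locally' s0 (fun s => E s = 0).
Proof.
  intros H1 H2 H3.
  destruct (locally_elim _ _ (filter_and _ _ H1 H2)) as (d & Hd & H4).
  clear H1 H2.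
  assert (H5 : forall e, 0 < e -> exists d', 0 < d' /\
     forall s, Rabs (s - s0) < d' -> s <> s0 -> E s < e).
  { intros e He. destruct (locally_elim _ _ (lim_near _ _ _ H3 e He)) as (d' & Hd' & H5).
    exists d'. split; auto. intros s S1 S2. specialize (H5 s S1 S2).
    apply Rabs_def2 in H5. lra. }
  apply locally_intro with d; auto. intros s Hs Hne.
  apply Rabs_def2 in Hs.
  destruct (Rdichotomy _ _ Hne) as [Hlt|Hlt].
  - replace (E s) with ((fun t => E (s0 - t)) (s0 - s)) by (f_equal; ring).
    apply (gronwall_right (fun t => E (s0 - t)) C d); auto; try lra.
    + intros t Ht. assert (A : Rabs (s0 - t - s0) = t).
      { replace (s0 - t - s0) with (- t) by ring. rewrite Rabs_Ropp, Rabs_right; lra. }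
      destruct (H4 (s0 - t)) as (K1 & E' & D1 & D2); [rewrite A; lra|lra|].
      rewrite A in D2. split; [exact K1|].
      exists (- E'). split.
      * replace (- E') with (scal (-1) E') by (unfold scal; simpl; unfold mult; simpl; ring).
        apply (is_derive_comp E (fun t => s0 - t)); auto. auto_derive; auto; ring.
      * lra.
    + intros e He. destruct (H5 e He) as (d' & Hd' & H6). exists d'. split; auto.
      intros t Ht. apply H6; [|lra].
      replace (s0 - t - s0) with (- t) by ring. rewrite Rabs_Ropp, Rabs_right; lra.
  - replace (E s) with ((fun t => E (s0 + t)) (s - s0)) by (f_equal; ring).
    apply (gronwall_right (fun t => E (s0 + t)) C d); auto; try lra.
    + intros t Ht. assert (A : Rabs (s0 + t - s0) = t).
      { replace (s0 + t - s0) with (t) by ring. rewrite Rabs_right; lra. }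
      destruct (H4 (s0 + t)) as (K1 & E' & D1 & D2); [rewrite A; lra|lra|].
      rewrite A in D2. split; [exact K1|].
      exists (E'). split.
      * replace (E') with (scal (1) E') by (unfold scal; simpl; unfold mult; simpl; ring).
        apply (is_derive_comp E (fun t => s0 + t)); auto. auto_derive; auto; ring.
      * lra.
    + intros e He. destruct (H5 e He) as (d' & Hd' & H6). exists d'. split; auto.
      intros t Ht. apply H6; [|lra].
      replace (s0 + t - s0) with t by ring. rewrite Rabs_right; lra.
Qed.

(** Only interior points of the segment matter, because the Gauss map of a
    helicoidal surface with nonzero pitch is never vertical
    (see [height_lt_1]). *)
Lemma C1_locally_lipschitz (h : R -> R) (hh : C1_m1_1 h) (l : R) :
  -1 < l < 1 ->
  exists L, 0 <= L /\ exists d, 0 < d /\ forall p q, Rabs (p - l) < d -> Rabs (q - l) < d ->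
      Rabs (h p - h q) <= L * Rabs (p - q).
Proof.
  intros Hl. destruct hh as [dh Hdh].
  assert (Hd : forall t, -1 < t < 1 -> is_derive h t (dh t)).
  { intros t Ht. destruct (Hdh t ltac:(lra)) as [K _].
    apply is_derive_Reals. intros eps Heps.
    destruct (K eps Heps) as (al & Hal & K2).
    assert (Hm : 0 < Rmin al (Rmin (1 - t) (t + 1))) by (repeat apply Rmin_glb_lt; lra).
    exists (mkposreal _ Hm). simpl. intros e He1 He2.
    pose proof (Rmin_l al (Rmin (1 - t) (t + 1))). pose proof (Rmin_r al (Rmin (1 - t) (t + 1))).
    pose proof (Rmin_l (1 - t) (t + 1)). pose proof (Rmin_r (1 - t) (t + 1)).
    assert (A : Rabs e < 1 - t) by lra. assert (B : Rabs e < t + 1) by lra.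
    apply Rabs_def2 in A. apply Rabs_def2 in B.
    specialize (K2 (t + e)). simpl in K2. unfold R_met, Rdist in K2. simpl in K2. unfold Rdist in K2.
    replace (t + e - t) with e in K2 by ring.
    apply K2. unfold D_x. repeat split; lra. }
  destruct (Hdh l ltac:(lra)) as [_ K].
  destruct (K 1 Rlt_0_1) as (al & Hal & K2).
  set (d := Rmin al (Rmin (1 - l) (l + 1))).
  assert (Hdp : 0 < d) by (unfold d; repeat apply Rmin_glb_lt; lra).
  assert (D1 : d <= al) by apply Rmin_l.
  assert (D2 : d <= 1 - l). { eapply Rle_trans; [apply Rmin_r|apply Rmin_l]. }
  assert (D3 : d <= l + 1). { eapply Rle_trans; [apply Rmin_r|apply Rmin_r]. }
  exists (Rabs (dh l) + 1). pose proof (Rabs_pos (dh l)). split; [lra|].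
  exists d. split; auto. intros p q Hp Hq.
  apply Rabs_def2 in Hp. apply Rabs_def2 in Hq.
  assert (M : Rmin q p <= Rmax q p) by (eapply Rle_trans; [apply Rmin_l|apply Rmax_l]).
  assert (M1 : l - d < Rmin q p) by (apply Rmin_glb_lt; lra).
  assert (M2 : Rmax q p < l + d) by (apply Rmax_lub_lt; lra).
  destruct (MVT_gen h q p dh) as [c [Hc1 Hc2]].
  - intros y Hy. apply Hd. lra.
  - intros y Hy. apply continuity_pt_filterlim. apply (ex_derive_continuous h y).
    exists (dh y). apply Hd. lra.
  - rewrite Hc2, Rabs_mult. apply Rmult_le_compat_r; [apply Rabs_pos|].
    destruct (Req_dec c l) as [->|Hcl]; [lra|].
    assert (Hdist : Rabs (dh c - dh l) < 1).
    { apply (K2 c). simpl. unfold Rdist. unfold D_x. repeat split; try lra.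
      apply Rabs_def1; lra. }
    replace (dh c) with ((dh c - dh l) + dh l) by ring.
    eapply Rle_trans; [apply Rabs_triang|]. lra.
Qed.

Lemma segment_induction (P : R -> Prop) (b : R) :
  0 <= b -> P 0 ->
  (forall t, 0 <= t <= b -> P t -> locally t P) ->
  (forall t, 0 < t <= b -> (forall y, 0 <= y < t -> P y) -> P t) ->
  P b.
Proof.
  intros Hb H0 Hop Hcl.
  set (A := fun t => 0 <= t <= b /\ forall y, 0 <= y <= t -> P y).
  destruct (completeness A) as [m [M1 M2]].
  { exists b. intros t [Ht _]. lra. }
  { exists 0. split; [lra|]. intros y Hy. replace y with 0 by lra. auto. }
  assert (A0 : 0 <= m). { apply M1. split; [lra|]. intros y Hy. replace y with 0 by lra. auto. }
  assert (Am : m <= b). { apply M2. intros t [Ht _]. lra. }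
  assert (Hlt : forall y, 0 <= y < m -> P y).
  { intros y Hy. destruct (classic (exists t, A t /\ y < t)) as [(t & [T1 T2] & T3)|K].
    - apply T2. lra.
    - assert (m <= y); [|lra]. apply M2. intros t At.
      destruct (Rle_lt_dec t y); auto. exfalso. apply K. exists t. auto. }
  assert (Pm : P m).
  { destruct (Rle_lt_or_eq_dec _ _ A0) as [K|K]; [|rewrite <- K; auto]. apply Hcl; auto. }
  destruct (Rle_lt_or_eq_dec _ _ Am) as [K|K]; [exfalso|rewrite <- K; auto].
  destruct (locally_elim _ _ (Hop m ltac:(lra) Pm)) as (d & Hd & Hy).
  set (t := Rmin (m + d / 2) b).
  assert (m < t) by (unfold t; apply Rmin_glb_lt; lra).
  assert (t <= m); [|lra].
  apply M1. pose proof (Rmin_l (m + d / 2) b). pose proof (Rmin_r (m + d / 2) b).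
  fold t in H1, H2. split; [lra|].
  intros y Y. destruct (Rle_lt_dec m y).
  - apply Hy. rewrite Rabs_right; lra.
  - apply Hlt. lra.
Qed.

(** * The profile equation away from the axis *)

(** The determinant of the first fundamental form, [x'^2 + z'^2 = 1] being taken
    into account, with [u] standing for [x']. *)
Definition area2 (c0 x u : R) : R := c0 ^ 2 * u ^ 2 + x ^ 2.

(** The vertical component of the unit normal. *)
Definition height (c0 x u : R) : R := x * u / sqrt (area2 c0 x u).

(** The right-hand side of the equation of prescribed mean curvature, once solved
    for [k * (x * (x ^ 2 + c0 ^ 2))], where [k] is the curvature of the profile. *)
Definition bending (c0 : R) (h : R -> R) (x u v : R) : R :=
  2 * (area2 c0 x u * sqrt (area2 c0 x u)) * h (height c0 x u)
  - 2 * c0 ^ 2 * u ^ 2 * v - x ^ 2 * v.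

(** The equation of prescribed mean curvature as a first-order system for the
    position [x] and the unit tangent [(u, v)] of the profile; it is singular
    where [x] vanishes. The curvature [k] is kept as a separate function because
    the last equation does not determine it on the axis. *)
Definition flow_at (c0 : R) (h x u v k : R -> R) (s : R) : Prop :=
  is_derive x s (u s) /\ is_derive u s (- k s * v s) /\ is_derive v s (k s * u s) /\
  u s ^ 2 + v s ^ 2 = 1 /\ 0 < area2 c0 (x s) (u s) /\
  k s * (x s * (x s ^ 2 + c0 ^ 2)) = bending c0 h (x s) (u s) (v s).

(** [area2 - (x u)^2 = c0^2 u^2 + x^2 (1 - u^2)] vanishes only if [u = 0] and
    [x = 0], which positive area excludes. *)
Lemma height_lt_1 (c0 x u v : R) :
  c0 <> 0 -> u ^ 2 + v ^ 2 = 1 -> 0 < area2 c0 x u -> -1 < height c0 x u < 1.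
Proof.
  intros Hc Huv HW. unfold height. set (W := area2 c0 x u) in *.
  assert (Hq := sqrt_lt_R0 _ HW). assert (Hqq := sqrt_sqrt W ltac:(lra)).
  set (q := sqrt W) in *.
  assert (H : (x * u) ^ 2 < q ^ 2).
  { replace (q ^ 2) with W by (rewrite <- Hqq; ring). unfold W, area2 in *.
    assert (0 < c0 ^ 2) by (apply pow2_gt_0; auto).
    destruct (Req_dec u 0) as [->|Hu]; [nra|].
    assert (0 < u ^ 2) by (apply pow2_gt_0; auto).
    pose proof (pow2_ge_0 (x * v)). nra. }
  assert (Hb : - q < x * u < q).
  { destruct (Rle_lt_dec q (x * u)); [nra|]. destruct (Rle_lt_dec (x * u) (-q)); nra. }
  split; apply Rmult_lt_reg_r with (1 := Hq);
    unfold Rdiv; rewrite Rmult_assoc, Rinv_l by lra; lra.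
Qed.

Lemma is_derive_filterlim (f : R -> R) (s l : R) :
  is_derive f s l -> filterlim f (locally s) (locally (f s)).
Proof. intros H. apply (ex_derive_continuous f s). exists l. exact H. Qed.

Lemma sq_sum_zero a b c : a ^ 2 + b ^ 2 + c ^ 2 = 0 -> a = 0 /\ b = 0 /\ c = 0.
Proof.
  intros H. pose proof (pow2_ge_0 a). pose proof (pow2_ge_0 b). pose proof (pow2_ge_0 c).
  repeat split; apply Rsqr_0_uniq; unfold Rsqr; nra.
Qed.

Lemma locally_locally' (P : R -> Prop) (s0 : R) : locally s0 P -> locally' s0 P.
Proof. intros H. unfold locally', within. revert H. apply filter_imp. auto. Qed.

Lemma filterlim_locally' (f : R -> R) (s0 : R) (G : (R -> Prop) -> Prop) :
  filterlim f (locally s0) G -> filterlim f (locally' s0) G.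
Proof. intros H P HP. apply locally_locally'. apply H. exact HP. Qed.

Lemma is_derive_sqr_diff (f g : R -> R) (s f' g' : R) :
  is_derive f s f' -> is_derive g s g' ->
  is_derive (fun t => (f t - g t) ^ 2) s (2 * (f s - g s) * (f' - g')).
Proof.
  intros Hf Hg.
  auto_derive. { repeat split; [exists f' | exists g']; assumption. }
  change (fun x => f x) with f. change (fun x => g x) with g.
  rewrite (is_derive_unique _ _ _ Hf), (is_derive_unique _ _ _ Hg). ring.
Qed.

Ltac lip :=
  lazymatch goal with
  | |- lip_close _ _ _ (fun s => @?f s - @?g s) _ => apply lip_minus; lip
  | |- lip_close _ _ _ (fun s => @?f s + @?g s) _ => apply lip_plus; lip
  | |- lip_close _ _ _ (fun s => @?f s * @?g s) _ => apply lip_mult; lip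
  | |- lip_close _ _ _ (fun s => @?f s ^ 2) _ => apply lip_sqr; lip
  | |- lip_close _ _ _ (fun s => - @?f s) _ => apply lip_opp; lip
  | |- lip_close _ _ _ (fun _ => ?c) _ => apply lip_const; lip
  | |- lip_close _ _ _ _ _ => assumption
  | |- _ => typeclasses eauto
  end.

Section LocalUniqueness.

Variables (c0 : R) (h : R -> R) (s0 : R).
Hypotheses (hc0 : c0 <> 0) (hh : C1_m1_1 h).
Variables x1 u1 v1 k1 x2 u2 v2 k2 : R -> R.
Hypothesis flow1 : locally s0 (flow_at c0 h x1 u1 v1 k1).
Hypothesis flow2 : locally s0 (flow_at c0 h x2 u2 v2 k2).
Hypotheses (Ex : x1 s0 = x2 s0) (Eu : u1 s0 = u2 s0) (Ev : v1 s0 = v2 s0).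

(** Where [x] is nonzero the curvature is a locally Lipschitz function of the
    position and of the tangent, so that the squared distance between the two
    solutions satisfies a Gronwall inequality. *)
Lemma flow_unique_off_axis :
  x1 s0 <> 0 ->
  locally s0 (fun s => x1 s = x2 s /\ u1 s = u2 s /\ v1 s = v2 s).
Proof.
  intros Hx0.
  destruct (locally_singleton _ _ flow1) as (X1 & U1 & V1 & N1 & W1 & _).
  destruct (locally_singleton _ _ flow2) as (X2 & U2 & V2 & _ & _ & _).
  set (D := fun s => Rabs (x1 s - x2 s) + Rabs (u1 s - u2 s) + Rabs (v1 s - v2 s)).
  assert (Hbase : forall (a b : R -> R) (p q : R), is_derive a s0 p -> is_derive b s0 q -> a s0 = b s0 ->
            (forall s, Rabs (a s - b s) <= D s) -> lip_close (locally s0) D (a s0) a b).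
  { intros a b p q Ha Hb Hab HD. split; [|split].
    - exact (is_derive_filterlim _ _ _ Ha).
    - rewrite Hab. exact (is_derive_filterlim _ _ _ Hb).
    - exists 1. split; [lra|]. apply filter_forall. intros s. rewrite Rmult_1_l. auto. }
  assert (Cx : lip_close (locally s0) D (x1 s0) x1 x2).
  { eapply Hbase; eauto. intros s. unfold D.
    pose proof (Rabs_pos (u1 s - u2 s)). pose proof (Rabs_pos (v1 s - v2 s)). lra. }
  assert (Cu : lip_close (locally s0) D (u1 s0) u1 u2).
  { eapply Hbase; eauto. intros s. unfold D.
    pose proof (Rabs_pos (x1 s - x2 s)). pose proof (Rabs_pos (v1 s - v2 s)). lra. }
  assert (Cv : lip_close (locally s0) D (v1 s0) v1 v2).
  { eapply Hbase; eauto. intros s. unfold D.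
    pose proof (Rabs_pos (x1 s - x2 s)). pose proof (Rabs_pos (u1 s - u2 s)). lra. }
  assert (CW : lip_close (locally s0) D (area2 c0 (x1 s0) (u1 s0))
                 (fun s => area2 c0 (x1 s) (u1 s)) (fun s => area2 c0 (x2 s) (u2 s))).
  { unfold area2. lip. }
  assert (Cq := lip_sqrt _ _ _ _ _ W1 CW).
  assert (Hq := sqrt_lt_R0 _ W1).
  assert (Cn : lip_close (locally s0) D (height c0 (x1 s0) (u1 s0))
                 (fun s => height c0 (x1 s) (u1 s)) (fun s => height c0 (x2 s) (u2 s))).
  { unfold height. apply lip_div; [typeclasses eauto|lra| |]; lip. }
  assert (Hn := height_lt_1 _ _ _ _ hc0 N1 W1).
  assert (Ch := lip_comp _ _ h _ _ _ (C1_locally_lipschitz h hh _ Hn) Cn). simpl in Ch.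
  assert (CB : lip_close (locally s0) D (bending c0 h (x1 s0) (u1 s0) (v1 s0))
                 (fun s => bending c0 h (x1 s) (u1 s) (v1 s))
                 (fun s => bending c0 h (x2 s) (u2 s) (v2 s))).
  { unfold bending. lip. }
  assert (Hden : x1 s0 * (x1 s0 ^ 2 + c0 ^ 2) <> 0).
  { apply Rmult_integral_contrapositive_currified; auto.
    assert (0 < c0 ^ 2) by (apply pow2_gt_0; auto). pose proof (pow2_ge_0 (x1 s0)). lra. }
  assert (Cd : lip_close (locally s0) D (x1 s0 * (x1 s0 ^ 2 + c0 ^ 2))
                 (fun s => x1 s * (x1 s ^ 2 + c0 ^ 2)) (fun s => x2 s * (x2 s ^ 2 + c0 ^ 2))).
  { lip. }
  assert (Hk : forall x u v k : R -> R, filterlim (fun s => x s * (x s ^ 2 + c0 ^ 2)) (locally s0)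
                   (locally (x1 s0 * (x1 s0 ^ 2 + c0 ^ 2))) ->
      locally s0 (flow_at c0 h x u v k) ->
      locally s0 (fun s => bending c0 h (x s) (u s) (v s) / (x s * (x s ^ 2 + c0 ^ 2)) = k s)).
  { intros x u v k Hl Hf.
    generalize (filter_and _ _ Hf (lim_away _ _ _ Hl Hden)).
    apply filter_imp. intros s ((_ & _ & _ & _ & _ & Hode) & Haway).
    rewrite <- Hode. field. 
    assert (Hp := Rabs_pos_lt _ Hden).
    assert (x s * (x s ^ 2 + c0 ^ 2) <> 0) by (intros K; rewrite K, Rabs_R0 in Haway; lra).
    split; intros K; apply H.
    - replace (x s ^ 2 + c0 ^ 2) with (c0 ^ 2 + x s ^ 2) by ring; simpl in *; nra.
    - rewrite K; ring. }
  assert (Ck : lip_close (locally s0) D (bending c0 h (x1 s0) (u1 s0) (v1 s0) / (x1 s0 * (x1 s0 ^ 2 + c0 ^ 2))) k1 k2).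
  { apply lip_ext with (4 := lip_div _ _ _ _ _ _ _ _ Hden CB Cd); auto with typeclass_instances.
    - apply Hk; auto. apply Cd.
    - apply Hk; auto. apply Cd. }
  assert (C1 := lip_mult _ _ _ _ _ _ _ _ (lip_opp _ _ _ _ _ Ck) Cv).
  assert (C2 := lip_mult _ _ _ _ _ _ _ _ Ck Cu).
  destruct C1 as (_ & _ & L1 & HL1 & B1). destruct C2 as (_ & _ & L2 & HL2 & B2).
  (* The distance [D] satisfies [D^2 <= 3 E], hence the constant [6] in the Gronwall inequality. *)
  set (E := fun s => (x1 s - x2 s) ^ 2 + (u1 s - u2 s) ^ 2 + (v1 s - v2 s) ^ 2).
  assert (HdE : forall (s a a' b b' c c' : R),
     is_derive x1 s a -> is_derive x2 s a' -> is_derive u1 s b -> is_derive u2 s b' ->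
     is_derive v1 s c -> is_derive v2 s c' ->
     is_derive E s (2 * (x1 s - x2 s) * (a - a') + 2 * (u1 s - u2 s) * (b - b')
                    + 2 * (v1 s - v2 s) * (c - c'))).
  { intros. apply (is_derive_plus (V := R_NormedModule) (fun s => (x1 s - x2 s) ^ 2 + (u1 s - u2 s) ^ 2)).
    apply (is_derive_plus (V := R_NormedModule) (fun s => (x1 s - x2 s) ^ 2)).
    all: apply is_derive_sqr_diff; auto. }
  assert (HE : locally' s0 (fun s => E s = 0)).
  { apply gronwall with (C := 6 * (1 + L1 + L2)).
    - apply filter_forall. intros s. unfold E.
      pose proof (pow2_ge_0 (x1 s - x2 s)). pose proof (pow2_ge_0 (u1 s - u2 s)).
      pose proof (pow2_ge_0 (v1 s - v2 s)). lra.
    - apply locally_locally'.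
      generalize (filter_and _ _ (filter_and _ _ flow1 flow2) (filter_and _ _ B1 B2)).
      apply filter_imp. intros s ((F1 & F2) & G1 & G2).
      destruct F1 as (X1' & U1' & V1' & _). destruct F2 as (X2' & U2' & V2' & _).
      exists (2 * (x1 s - x2 s) * (u1 s - u2 s)
             + 2 * (u1 s - u2 s) * (- k1 s * v1 s - - k2 s * v2 s)
             + 2 * (v1 s - v2 s) * (k1 s * u1 s - k2 s * u2 s)). split.
      + apply HdE; auto.
      + set (A := - k1 s * v1 s - - k2 s * v2 s) in *.
        set (B := k1 s * u1 s - k2 s * u2 s) in *.
        unfold D in G1, G2. unfold E.
        set (a := x1 s - x2 s) in *. set (b := u1 s - u2 s) in *. set (c := v1 s - v2 s) in *.
        rewrite <- (pow2_abs a), <- (pow2_abs b), <- (pow2_abs c).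
        eapply Rle_trans; [apply Rle_abs|]. rewrite Rabs_mult.
        match goal with |- _ <= ?C * ?r * ?e =>
          replace (C * r * e) with (r * (C * e)) by ring end.
        apply Rmult_le_compat_l; [apply Rabs_pos|].
        eapply Rle_trans; [apply Rabs_triang|].
        eapply Rle_trans; [apply Rplus_le_compat_r; apply Rabs_triang|].
        rewrite !Rabs_mult, !(Rabs_right 2) by lra.
        pose proof (Rabs_pos a). pose proof (Rabs_pos b). pose proof (Rabs_pos c).
        set (p := Rabs a) in *. set (q := Rabs b) in *. set (r := Rabs c) in *.
        assert (q * Rabs A <= q * (L1 * (p + q + r))) by (apply Rmult_le_compat_l; auto).
        assert (r * Rabs B <= r * (L2 * (p + q + r))) by (apply Rmult_le_compat_l; auto).
        assert (S0 : (p + q + r) * (p + q + r) <= 3 * (p ^ 2 + q ^ 2 + r ^ 2)).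
        { pose proof (pow2_ge_0 (p - q)). pose proof (pow2_ge_0 (p - r)). pose proof (pow2_ge_0 (q - r)). nra. }
        assert (S1 : p * q <= 3 * (p ^ 2 + q ^ 2 + r ^ 2)) by nra.
        assert (S2 : q * (p + q + r) <= 3 * (p ^ 2 + q ^ 2 + r ^ 2)) by nra.
        assert (S3 : r * (p + q + r) <= 3 * (p ^ 2 + q ^ 2 + r ^ 2)) by nra.
        pose proof (Rmult_le_compat_l _ _ _ HL1 S2). pose proof (Rmult_le_compat_l _ _ _ HL2 S3).
        lra.
    - apply filterlim_locally'.
      replace 0 with (E s0).
      2: { unfold E. rewrite Ex, Eu, Ev. ring. }
      apply (is_derive_filterlim E s0 (2 * (x1 s0 - x2 s0) * (u1 s0 - u2 s0)
             + 2 * (u1 s0 - u2 s0) * (- k1 s0 * v1 s0 - - k2 s0 * v2 s0)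
             + 2 * (v1 s0 - v2 s0) * (k1 s0 * u1 s0 - k2 s0 * u2 s0))).
      apply HdE; auto. }
  destruct (locally_elim _ _ HE) as (d & Hd & HE').
  apply locally_intro with d; auto. intros s Hs.
  destruct (Req_dec s s0) as [->|Hne]; auto.
  specialize (HE' s Hs Hne). destruct (sq_sum_zero _ _ _ HE') as (Z1 & Z2 & Z3). lra.
Qed.

End LocalUniqueness.

(** * The profile equation on the axis *)

(** Up to a sign, the quotient of the radial component of the unit normal by
    [x]. It satisfies the simple equation [tilt_derive], and together
    with [x] it determines the profile tangent up to the sign of [u]. *)
Definition tilt (c0 x u v : R) : R := v / sqrt (area2 c0 x u).

Lemma tilt_sqr c0 x u v :
  0 < area2 c0 x u -> tilt c0 x u v ^ 2 = v ^ 2 / area2 c0 x u.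
Proof.
  intros HW. unfold tilt, Rdiv. rewrite Rpow_mult_distr, pow_inv, pow2_sqrt; lra.
Qed.

Lemma area2_tilt c0 x u v :
  u ^ 2 + v ^ 2 = 1 -> 0 < area2 c0 x u ->
  area2 c0 x u = (c0 ^ 2 + x ^ 2) / (1 + c0 ^ 2 * tilt c0 x u v ^ 2).
Proof.
  intros Huv HW. rewrite tilt_sqr by auto.
  set (W := area2 c0 x u) in *.
  assert (HWv : W + c0 ^ 2 * v ^ 2 = c0 ^ 2 + x ^ 2).
  { unfold W, area2. replace (v ^ 2) with (1 - u ^ 2) by lra. ring. }
  pose proof (pow2_ge_0 (c0 * v)).
  rewrite <- HWv. field. split; nra.
Qed.

Lemma sqr_slope_tilt c0 x u v :
  u ^ 2 + v ^ 2 = 1 -> 0 < area2 c0 x u ->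
  u ^ 2 = (1 - tilt c0 x u v ^ 2 * x ^ 2) / (1 + c0 ^ 2 * tilt c0 x u v ^ 2).
Proof.
  intros Huv HW. rewrite tilt_sqr by auto.
  set (W := area2 c0 x u) in *.
  assert (HWv : W + c0 ^ 2 * v ^ 2 = c0 ^ 2 + x ^ 2).
  { unfold W, area2. replace (v ^ 2) with (1 - u ^ 2) by lra. ring. }
  assert (HWx : W - v ^ 2 * x ^ 2 = u ^ 2 * (c0 ^ 2 + x ^ 2)).
  { unfold W, area2. replace (v ^ 2) with (1 - u ^ 2) by lra. ring. }
  pose proof (pow2_ge_0 (c0 * v)).
  assert (HD : W + c0 ^ 2 * v ^ 2 <> 0) by nra.
  replace ((1 - v ^ 2 / W * x ^ 2) / (1 + c0 ^ 2 * (v ^ 2 / W)))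
    with ((W - v ^ 2 * x ^ 2) / (W + c0 ^ 2 * v ^ 2)).
  - rewrite HWx, <- HWv. field. rewrite Rpow_mult_distr. exact HD.
  - field. split; nra.
Qed.

(** The flux balance [(x^2 tilt)' = 2 x x' h(height)] for vertical translations,
    which are isometries preserving the equation, in expanded form. The
    singular term is exactly [-2 x' tilt / x], whose sign is the source
    of uniqueness on the axis. *)
Lemma tilt_derive c0 h (x u v k : R -> R) s :
  flow_at c0 h x u v k s -> x s <> 0 ->
  is_derive (fun t => tilt c0 (x t) (u t) (v t)) s
    (2 * (u s / x s) * (h (height c0 (x s) (u s)) - tilt c0 (x s) (u s) (v s))).
Proof.
  intros (X & U & V & N & W & Hode) Hx.
  unfold tilt, bending in *. set (H := h (height c0 (x s) (u s))) in *.
  assert (Hq := sqrt_lt_R0 _ W). assert (Hqq := sqrt_sqrt _ (Rlt_le _ _ W)).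
  set (q := sqrt (area2 c0 (x s) (u s))) in *.
  assert (DW : is_derive (fun t => area2 c0 (x t) (u t)) s
                 (2 * c0 ^ 2 * u s * (- k s * v s) + 2 * x s * u s)).
  { unfold area2. auto_derive.
    - repeat split; [exists (- k s * v s) | exists (u s)]; assumption.
    - change (fun t => x t) with x. change (fun t => u t) with u. rewrite (is_derive_unique _ _ _ X), (is_derive_unique _ _ _ U). ring. }
  assert (Dq : is_derive (fun t => sqrt (area2 c0 (x t) (u t))) s
                 ((2 * c0 ^ 2 * u s * (- k s * v s) + 2 * x s * u s) / (2 * q))).
  { apply is_derive_sqrt; assumption. }
  assert (Hq0 : q <> 0) by lra.
  assert (Dw := is_derive_div _ _ s _ _ V Dq Hq0). cbv beta in Dw. fold q in Dw.
  match type of Dw with is_derive _ _ ?d => 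
    replace (2 * (u s / x s) * (H - v s / q)) with d; [exact Dw|] end.
  apply Rmult_eq_reg_r with (x s * (q * q * q)).
  2: { repeat apply Rmult_integral_contrapositive_currified; lra. }
  transitivity (u s * (k s * (x s * (q * q + c0 ^ 2 * v s ^ 2)) - x s ^ 2 * v s)).
  { field. lra. }
  transitivity (2 * u s * (q * q * q * H - v s * (q * q))).
  2: { field. lra. }
  rewrite Hqq. unfold area2 in *.
  replace (c0 ^ 2 * u s ^ 2 + x s ^ 2 + c0 ^ 2 * v s ^ 2) with (x s ^ 2 + c0 ^ 2).
  2: { replace (v s ^ 2) with (1 - u s ^ 2) by lra. ring. }
  rewrite Hode. ring.
Qed.

(** The quadratic form that governs the energy of [flow_unique_on_axis]. The
    weight [K] absorbs the cross term [Lu * dx * dw], and [e] is small enough for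
    the remaining terms to be absorbed by the two negative squares. *)
Lemma axis_energy_decay (dx dw du dh da a g Lu La e K : R) :
  0 <= Lu -> 0 <= La -> K = Lu ^ 2 + 1 -> e = / (32 * K * (La + 1)) ->
  Rabs du <= Lu * Rabs dw + Rabs dx / 4 ->
  Rabs dh <= e * (Rabs dx + Rabs dw) ->
  Rabs da <= La * (Rabs dx + Rabs dw) ->
  Rabs g <= e -> 1 / 2 <= a <= 2 ->
  2 * dx * (du - dx) + K * (2 * dw * (2 * (a * (dh - dw) + da * g))) <= 0.
Proof.
  intros HLu HLa HK He Hdu Hdh Hda Hg Ha.
  assert (HKp : 1 <= K) by (rewrite HK; pose proof (pow2_ge_0 Lu); lra).
  assert (Hep : 0 < e).
  { rewrite He. apply Rinv_0_lt_compat. apply Rmult_lt_0_compat; lra. }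
  assert (HeK : K * e * (La + 1) = / 32). { rewrite He. field. split; lra. }
  set (d := Rabs dx) in *. set (q := Rabs dw) in *.
  assert (Hd : 0 <= d) by apply Rabs_pos. assert (Hq : 0 <= q) by apply Rabs_pos.
  assert (Ed : dx * dx = d * d) by (unfold d; rewrite <- Rabs_mult, Rabs_right; [auto|nra]).
  assert (Eq : dw * dw = q * q) by (unfold q; rewrite <- Rabs_mult, Rabs_right; [auto|nra]).
  assert (T1 : dx * du <= d * (Lu * q + d / 4)).
  { eapply Rle_trans; [apply Rle_abs|]. rewrite Rabs_mult.
    apply Rmult_le_compat_l; auto. }
  assert (T2 : dw * dh <= q * (e * (d + q))).
  { eapply Rle_trans; [apply Rle_abs|]. rewrite Rabs_mult.
    apply Rmult_le_compat_l; auto. }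
  assert (T3 : dw * (da * g) <= q * (La * (d + q) * e)).
  { eapply Rle_trans; [apply Rle_abs|]. rewrite !Rabs_mult.
    apply Rmult_le_compat_l; auto. apply Rmult_le_compat; auto using Rabs_pos. }
  assert (T4 : a * (dw * dh) <= 2 * (q * (e * (d + q)))).
  { assert (0 <= q * (e * (d + q))) by (apply Rmult_le_pos; nra).
    destruct (Rle_lt_dec 0 (dw * dh)); nra. }
  assert (T5 : q * q / 2 <= a * (dw * dw)) by nra.
  assert (T6 : K * (a * (dw * dh) - a * (dw * dw) + dw * (da * g)) <=
               q * (d + q) / 16 - K * (q * q) / 2).
  { apply Rle_trans with (K * (2 * (q * (e * (d + q))) - q * q / 2 + q * (La * (d + q) * e))).
    - apply Rmult_le_compat_l; lra.
    - replace (K * (2 * (q * (e * (d + q))) - q * q / 2 + q * (La * (d + q) * e)))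
        with (q * (d + q) * (K * e * (La + 1) + K * e) - K * (q * q) / 2) by field.
      assert (0 <= K * e) by nra.
      assert (K * e <= / 32) by nra.
      assert (0 <= q * (d + q)) by nra.
      rewrite HeK. nra. }
  pose proof (pow2_ge_0 (d / 2 - Lu * q)). pose proof (pow2_ge_0 (d - q)).
  rewrite HK in *. nra.
Qed.

(** At [x = 0] the equation no longer involves the curvature and becomes a
    condition on the direction of the profile. *)
Lemma tilt_on_axis c0 h x u v k s0 :
  flow_at c0 h x u v k s0 -> x s0 = 0 -> tilt c0 (x s0) (u s0) (v s0) = h 0.
Proof.
  intros (_ & _ & _ & N & W & Hode) Hx.
  unfold tilt, bending, height in *.
  assert (Hq := sqrt_lt_R0 _ W). assert (Hqq := sqrt_sqrt _ (Rlt_le _ _ W)).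
  set (q := sqrt (area2 c0 (x s0) (u s0))) in *. rewrite <- Hqq in Hode.
  assert (E : q * q = c0 ^ 2 * u s0 ^ 2). { rewrite Hqq. unfold area2. rewrite Hx. ring. }
  rewrite Hx in Hode. unfold Rdiv in Hode. rewrite !Rmult_0_l in Hode.
  assert (Z : q * q * (q * h 0 - v s0) = 0). { rewrite E in *. nra. }
  apply Rmult_integral in Z. destruct Z as [Z|Z]; [nra|].
  apply Rmult_eq_reg_r with q; [|lra]. unfold Rdiv.
  rewrite Rmult_assoc, Rinv_l by lra. lra.
Qed.

Lemma tilt_continuous c0 h x u v k s0 :
  flow_at c0 h x u v k s0 ->
  filterlim (fun s => tilt c0 (x s) (u s) (v s)) (locally s0)
    (locally (tilt c0 (x s0) (u s0) (v s0))).
Proof.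
  intros (X & U & V & N & W & _).
  assert (Cx := lip_refl (locally s0) (fun _ => 0) _ _ (is_derive_filterlim _ _ _ X)).
  assert (Cu := lip_refl (locally s0) (fun _ => 0) _ _ (is_derive_filterlim _ _ _ U)).
  assert (Cv := lip_refl (locally s0) (fun _ => 0) _ _ (is_derive_filterlim _ _ _ V)).
  assert (CW : lip_close (locally s0) (fun _ => 0) (area2 c0 (x s0) (u s0))
                 (fun s => area2 c0 (x s) (u s)) (fun s => area2 c0 (x s) (u s))).
  { unfold area2. lip. }
  assert (Cq := lip_sqrt _ _ _ _ _ W CW).
  assert (Hq := sqrt_lt_R0 _ W).
  assert (Ct : lip_close (locally s0) (fun _ => 0) (tilt c0 (x s0) (u s0) (v s0))
                 (fun s => tilt c0 (x s) (u s) (v s)) (fun s => tilt c0 (x s) (u s) (v s))).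
  { unfold tilt. apply lip_div; [typeclasses eauto | lra | |]; lip. }
  apply Ct.
Qed.

Section LocalUniquenessOnAxis.

Variables (c0 : R) (h : R -> R) (s0 : R).
Hypotheses (hc0 : c0 <> 0) (hh : C1_m1_1 h).
Variables x1 u1 v1 k1 x2 u2 v2 k2 : R -> R.
Hypothesis flow1 : locally s0 (flow_at c0 h x1 u1 v1 k1).
Hypothesis flow2 : locally s0 (flow_at c0 h x2 u2 v2 k2).
Hypotheses (Ex : x1 s0 = x2 s0) (Eu : u1 s0 = u2 s0) (Ev : v1 s0 = v2 s0).

(** With [y = x / (s - s0)] and [w] the tilt, the system becomes
    [(s - s0) y' = x' - y] and [(s - s0) w' = 2 (x' / y) (h - w)], where [x' / y]
    tends to [1]. The terms [- y] and [- 2 w] are dissipative, and [x'] depends on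
    [w] and on [x = (s - s0) y] only, by [sqr_slope_tilt]; so a weighted sum of the
    squares of the differences of [y] and [w] cannot increase away from
    [s0], where it tends to zero. *)
Lemma flow_unique_on_axis :
  x1 s0 = 0 -> u1 s0 <> 0 ->
  locally s0 (fun s => x1 s = x2 s /\ u1 s = u2 s /\ v1 s = v2 s).
Proof.
  intros Hx0 Hu0.
  destruct (locally_singleton _ _ flow1) as (X1 & U1 & V1 & N1 & W1 & _).
  destruct (locally_singleton _ _ flow2) as (X2 & U2 & V2 & N2 & W2 & _).
  set (F := locally' s0). assert (FF : Filter F) by typeclasses eauto.
  set (w1 := fun s => tilt c0 (x1 s) (u1 s) (v1 s)).
  set (w2 := fun s => tilt c0 (x2 s) (u2 s) (v2 s)).
  assert (Hw1 : w1 s0 = h 0).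
  { apply (tilt_on_axis c0 h x1 u1 v1 k1); auto. apply (locally_singleton _ _ flow1). }
  assert (Lw1 : filterlim w1 F (locally (h 0))).
  { rewrite <- Hw1. apply filterlim_locally'. apply (tilt_continuous c0 h x1 u1 v1 k1).
    apply (locally_singleton _ _ flow1). }
  assert (Lw2 : filterlim w2 F (locally (h 0))).
  { rewrite <- Hw1. replace (w1 s0) with (w2 s0) by (unfold w1, w2; rewrite Ex, Eu, Ev; auto).
    apply filterlim_locally'. apply (tilt_continuous c0 h x2 u2 v2 k2).
    apply (locally_singleton _ _ flow2). }
  (* The slopes must be compared through [D], which involves [x] and not the
     quotient [y]: the difference of the [y] then enters with the small factor
     [s - s0]. *)
  set (D := fun s => Rabs (w1 s - w2 s) + Rabs (x1 s - x2 s)).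
  assert (Cw : lip_close F D (h 0) w1 w2).
  { split; [|split]; auto. exists 1. split; [lra|]. apply filter_forall. intros s.
    unfold D. pose proof (Rabs_pos (x1 s - x2 s)). lra. }
  assert (Cx : lip_close F D 0 x1 x2).
  { split; [|split].
    - rewrite <- Hx0. apply filterlim_locally'. exact (is_derive_filterlim _ _ _ X1).
    - rewrite <- Hx0, Ex. apply filterlim_locally'. exact (is_derive_filterlim _ _ _ X2).
    - exists 1. split; [lra|]. apply filter_forall. intros s.
      unfold D. pose proof (Rabs_pos (w1 s - w2 s)). lra. }
  assert (Hden : 0 < 1 + c0 ^ 2 * h 0 ^ 2).
  { pose proof (pow2_ge_0 (c0 * h 0)). rewrite Rpow_mult_distr in H. lra. }
  assert (Hc2 : 0 < c0 ^ 2) by (apply pow2_gt_0; auto).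
  assert (CW : lip_close F D ((c0 ^ 2 + 0 ^ 2) / (1 + c0 ^ 2 * h 0 ^ 2))
                 (fun s => area2 c0 (x1 s) (u1 s)) (fun s => area2 c0 (x2 s) (u2 s))).
  { apply lip_ext with (a := fun s => (c0 ^ 2 + x1 s ^ 2) / (1 + c0 ^ 2 * w1 s ^ 2))
                       (b := fun s => (c0 ^ 2 + x2 s ^ 2) / (1 + c0 ^ 2 * w2 s ^ 2)).
    - typeclasses eauto.
    - apply locally_locally'. revert flow1. apply filter_imp.
      intros s (_ & _ & _ & N & W & _). symmetry. apply area2_tilt; auto.
    - apply locally_locally'. revert flow2. apply filter_imp.
      intros s (_ & _ & _ & N & W & _). symmetry. apply area2_tilt; auto.
    - apply lip_div; [typeclasses eauto | lra | |]; lip. }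
  (* The square of the slope is a function of [x] and [w]; its sign is that of [u1 s0]. *)
  assert (Cu : lip_close F D (u1 s0) u1 u2).
  { apply lip_of_sqr with ((1 - h 0 ^ 2 * 0 ^ 2) / (1 + c0 ^ 2 * h 0 ^ 2)).
    - typeclasses eauto.
    - exact Hu0.
    - apply filterlim_locally'. exact (is_derive_filterlim _ _ _ U1).
    - rewrite Eu. apply filterlim_locally'. exact (is_derive_filterlim _ _ _ U2).
    - apply lip_ext with (a := fun s => (1 - w1 s ^ 2 * x1 s ^ 2) / (1 + c0 ^ 2 * w1 s ^ 2))
                       (b := fun s => (1 - w2 s ^ 2 * x2 s ^ 2) / (1 + c0 ^ 2 * w2 s ^ 2)).
      + typeclasses eauto.
      + apply locally_locally'. revert flow1. apply filter_imp.
        intros s (_ & _ & _ & N & W & _). symmetry. apply sqr_slope_tilt; auto.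
      + apply locally_locally'. revert flow2. apply filter_imp.
        intros s (_ & _ & _ & N & W & _). symmetry. apply sqr_slope_tilt; auto.
      + apply lip_div; [typeclasses eauto | lra | |]; lip. }
  assert (HW0 : 0 < (c0 ^ 2 + 0 ^ 2) / (1 + c0 ^ 2 * h 0 ^ 2)).
  { apply Rdiv_lt_0_compat; lra. }
  assert (Cq := lip_sqrt _ _ _ _ _ HW0 CW). cbv beta in Cq.
  assert (Hq0 := sqrt_lt_R0 _ HW0).
  set (q0 := sqrt ((c0 ^ 2 + 0 ^ 2) / (1 + c0 ^ 2 * h 0 ^ 2))) in *.
  assert (Cb : lip_close F D (u1 s0 / q0) (fun s => u1 s / sqrt (area2 c0 (x1 s) (u1 s)))
                 (fun s => u2 s / sqrt (area2 c0 (x2 s) (u2 s)))).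
  { apply lip_div; [typeclasses eauto | lra | |]; lip. }
  set (b1 := fun s => u1 s / sqrt (area2 c0 (x1 s) (u1 s))) in *.
  set (b2 := fun s => u2 s / sqrt (area2 c0 (x2 s) (u2 s))) in *.
  set (y1 := fun s => x1 s / (s - s0)). set (y2 := fun s => x2 s / (s - s0)).
  assert (Ly : forall (x : R -> R) (l : R), is_derive x s0 l -> x s0 = 0 ->
             filterlim (fun s => x s / (s - s0)) F (locally l)).
  { intros x l Hd Hx. apply lim_of_near; [typeclasses eauto|]. intros e He.
    apply is_derive_Reals in Hd. destruct (Hd e He) as [d Hdd].
    apply locally_intro with d; [apply cond_pos|]. intros s Hs Hne.
    specialize (Hdd (s - s0)). replace (s0 + (s - s0)) with s in Hdd by ring.
    rewrite Hx, Rminus_0_r in Hdd. apply Hdd; auto. lra. }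
  assert (Ly1 := Ly _ _ X1 Hx0 : filterlim y1 F (locally (u1 s0))).
  assert (Ly2 : filterlim y2 F (locally (u1 s0))).
  { rewrite Eu. apply (Ly x2 _ X2). lra. }
  set (D2 := fun s => Rabs (y1 s - y2 s) + Rabs (w1 s - w2 s)).
  assert (Cy : lip_close F D2 (u1 s0) y1 y2).
  { split; [|split]; auto. exists 1. split; [lra|]. apply filter_forall. intros s.
    unfold D2. pose proof (Rabs_pos (w1 s - w2 s)). lra. }
  assert (Hr : forall e, 0 < e -> F (fun s => Rabs (s - s0) <= e)).
  { intros e He. apply locally_intro with e; auto. intros s Hs _. lra. }
  assert (Hne : F (fun s => s <> s0)).
  { apply locally_intro with 1; [lra|]. intros s _ Hs. exact Hs. }
  assert (Hdx : F (fun s => Rabs (x1 s - x2 s) = Rabs (s - s0) * Rabs (y1 s - y2 s))).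
  { generalize Hne. apply filter_imp. intros s Hs. rewrite <- Rabs_mult. f_equal.
    unfold y1, y2. field. lra. }
  assert (HDD : F (fun s => D s <= D2 s)).
  { generalize (filter_and _ _ Hdx (Hr 1 Rlt_0_1)). apply filter_imp.
    intros s (E1 & E2). unfold D, D2. rewrite E1.
    pose proof (Rabs_pos (y1 s - y2 s)). nra. }
  assert (Ca : lip_close F D2 (u1 s0 / u1 s0) (fun s => u1 s / y1 s) (fun s => u2 s / y2 s)).
  { apply lip_div; [typeclasses eauto | exact Hu0 | | exact Cy].
    apply (lip_mono F D D2); assumption. }
  set (a1 := fun s => u1 s / y1 s) in *. set (a2 := fun s => u2 s / y2 s) in *.
  replace (u1 s0 / u1 s0) with 1 in Ca by (field; auto).
  assert (Ll := C1_locally_lipschitz h hh 0 ltac:(lra)).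
  destruct Ll as (Lh & HLh & dh & Hdh & Hlip).
  assert (Cn : lip_close F D (0 * (u1 s0 / q0)) (fun s => x1 s * b1 s) (fun s => x2 s * b2 s)).
  { lip. }
  replace (0 * (u1 s0 / q0)) with 0 in Cn by ring.
  destruct Cu as (_ & _ & Lu & HLu & Bu).
  destruct Cb as (_ & Lb2 & Lb & HLb & Bb).
  destruct Ca as (La1 & _ & La & HLa & Ba).
  destruct Cn as (Ln1 & Ln2 & _).
  destruct Cx as (Lx1 & _ & _).
  set (K := Lu ^ 2 + 1). set (e := / (32 * K * (La + 1))).
  assert (HKp : 0 < K) by (unfold K; pose proof (pow2_ge_0 Lu); lra).
  assert (Hep : 0 < e).
  { unfold e. apply Rinv_0_lt_compat. repeat apply Rmult_lt_0_compat; lra. }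
  set (M := Lh * (Lb + (Rabs (u1 s0 / q0) + 1))).
  assert (HM : 0 <= M).
  { unfold M. pose proof (Rabs_pos (u1 s0 / q0)). apply Rmult_le_pos; lra. }
  set (e2 := e / (M + 1)).
  assert (He2 : 0 < e2) by (unfold e2; apply Rdiv_lt_0_compat; lra).
  assert (HMe : M * e2 <= e).
  { unfold e2. apply Rmult_le_reg_r with (M + 1); [lra|].
    replace (M * (e / (M + 1)) * (M + 1)) with (M * e) by (field; lra). nra. }
  (* The height is [x] times the Lipschitz-close functions [b1] and [b2], and [x]
     tends to zero, so any positive constant is eventually admissible here. *)
  assert (Bh : F (fun s => Rabs (h (x1 s * b1 s) - h (x2 s * b2 s)) <= e * D2 s)).
  { generalize (filter_and _ _ (filter_and _ _ (lim_near _ _ _ Ln1 dh Hdh) (lim_near _ _ _ Ln2 dh Hdh))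
      (filter_and _ _ (filter_and _ _ (lim_near _ _ _ Lx1 e2 He2) (Hr e2 He2))
        (filter_and _ _ (filter_and _ _ HDD Hdx) (filter_and _ _ Bb (lim_bounded _ _ _ Lb2))))).
    apply filter_imp. intros s ((A1 & A2) & (A3 & A4) & (A5 & A6) & A7 & A8).
    eapply Rle_trans; [apply Hlip; auto|].
    rewrite Rminus_0_r in A3.
    assert (HD0 : 0 <= D s).
    { unfold D. pose proof (Rabs_pos (w1 s - w2 s)). pose proof (Rabs_pos (x1 s - x2 s)). lra. }
    assert (HD2 : Rabs (y1 s - y2 s) <= D2 s).
    { unfold D2. pose proof (Rabs_pos (w1 s - w2 s)). lra. }
    assert (HD20 : 0 <= D2 s) by lra.
    assert (Q : Rabs (x1 s * b1 s - x2 s * b2 s) <= (Lb + (Rabs (u1 s0 / q0) + 1)) * e2 * D2 s).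
    { replace (x1 s * b1 s - x2 s * b2 s) with (x1 s * (b1 s - b2 s) + (x1 s - x2 s) * b2 s) by ring.
      eapply Rle_trans; [apply Rabs_triang|]. rewrite !Rabs_mult, A6.
      assert (Rabs (x1 s) * Rabs (b1 s - b2 s) <= e2 * (Lb * D2 s)).
      { apply Rmult_le_compat; try apply Rabs_pos; [lra|]. nra. }
      assert (Rabs (s - s0) * Rabs (y1 s - y2 s) * Rabs (b2 s) <= e2 * D2 s * (Rabs (u1 s0 / q0) + 1)).
      { apply Rmult_le_compat; try apply Rabs_pos; auto.
        - apply Rmult_le_pos; apply Rabs_pos.
        - apply Rmult_le_compat; try apply Rabs_pos; auto. }
      lra. }
    apply Rle_trans with (Lh * ((Lb + (Rabs (u1 s0 / q0) + 1)) * e2 * D2 s)).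
    - apply Rmult_le_compat_l; auto.
    - replace (Lh * ((Lb + (Rabs (u1 s0 / q0) + 1)) * e2 * D2 s)) with (M * e2 * D2 s)
        by (unfold M; ring).
      apply Rmult_le_compat_r; auto. }
  (* Both [h (height)] and the tilt tend to [h 0]. *)
  assert (Bg : F (fun s => Rabs (h (x2 s * b2 s) - w2 s) <= e)).
  { assert (He5 : 0 < e / 2) by lra.
    assert (He4 : 0 < Rmin dh (e / (2 * (Lh + 1)))).
    { apply Rmin_glb_lt; auto. apply Rdiv_lt_0_compat; lra. }
    generalize (filter_and _ _ (lim_near _ _ _ Ln2 _ He4) (lim_near _ _ _ Lw2 _ He5)).
    apply filter_imp. intros s (A1 & A2).
    assert (A3 := Rlt_le_trans _ _ _ A1 (Rmin_l _ _)).
    assert (A4 := Rlt_le_trans _ _ _ A1 (Rmin_r _ _)).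
    replace (h (x2 s * b2 s) - w2 s) with ((h (x2 s * b2 s) - h 0) - (w2 s - h 0)) by ring.
    eapply Rle_trans; [apply Rabs_triang|]. rewrite Rabs_Ropp.
    assert (Rabs (h (x2 s * b2 s) - h 0) <= Lh * Rabs (x2 s * b2 s - 0)).
    { apply Hlip; auto. rewrite Rminus_diag, Rabs_R0; auto. }
    assert (Lh * Rabs (x2 s * b2 s - 0) <= e / 2); [|lra].
    apply Rle_trans with (Lh * (e / (2 * (Lh + 1)))).
    - apply Rmult_le_compat_l; lra.
    - apply Rmult_le_reg_r with (Lh + 1); [lra|].
      replace (Lh * (e / (2 * (Lh + 1))) * (Lh + 1)) with (Lh * (e / 2)) by (field; lra). nra. }
  set (E := fun s => (y1 s - y2 s) ^ 2 + K * (w1 s - w2 s) ^ 2).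
  assert (HE : F (fun s => E s = 0)).
  { apply gronwall with (C := 0).
    - apply filter_forall. intros s. unfold E.
      pose proof (pow2_ge_0 (y1 s - y2 s)). pose proof (pow2_ge_0 (w1 s - w2 s)). nra.
    - assert (Hhalf : 0 < 1 / 2) by lra.
      assert (Hru : 0 < / (4 * (Lu + 1))) by (apply Rinv_0_lt_compat; lra).
      generalize (filter_and _ _ (filter_and _ _ (locally_locally' _ _ flow1) (locally_locally' _ _ flow2))
        (filter_and _ _ (filter_and _ _ (filter_and _ _ Bu Ba) (filter_and _ _ Bh Bg))
        (filter_and _ _ (filter_and _ _ Hne Hdx)
        (filter_and _ _ (filter_and _ _ (Hr _ Hru) (lim_near _ _ _ La1 _ Hhalf))
          (filter_and _ _ (lim_away _ _ _ Ly1 Hu0) (lim_away _ _ _ Ly2 Hu0)))))).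
      apply filter_imp.
      intros s ((G1 & G2) & ((A1 & A2) & A3 & A4) & (A5 & A6) & (A7 & A8) & A9 & A10).
      assert (Hrs : s - s0 <> 0) by lra.
      assert (Hup := Rabs_pos_lt _ Hu0).
      assert (Hy1 : y1 s <> 0) by (intros Z; rewrite Z, Rabs_R0 in A9; lra).
      assert (Hy2 : y2 s <> 0) by (intros Z; rewrite Z, Rabs_R0 in A10; lra).
      assert (Hx1 : x1 s = (s - s0) * y1 s) by (unfold y1; field; lra).
      assert (Hx2 : x2 s = (s - s0) * y2 s) by (unfold y2; field; lra).
      assert (Hx1n : x1 s <> 0) by (rewrite Hx1; apply Rmult_integral_contrapositive_currified; auto).
      assert (Hx2n : x2 s <> 0) by (rewrite Hx2; apply Rmult_integral_contrapositive_currified; auto).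
      assert (Dw1 := tilt_derive c0 h x1 u1 v1 k1 s G1 Hx1n).
      assert (Dw2 := tilt_derive c0 h x2 u2 v2 k2 s G2 Hx2n).
      fold (w1 s) in Dw1. fold (w2 s) in Dw2.
      assert (Hn1 : height c0 (x1 s) (u1 s) = x1 s * b1 s) by (unfold height, b1, Rdiv; ring).
      assert (Hn2 : height c0 (x2 s) (u2 s) = x2 s * b2 s) by (unfold height, b2, Rdiv; ring).
      rewrite Hn1 in Dw1. rewrite Hn2 in Dw2.
      set (g1 := h (x1 s * b1 s)) in *. set (g2 := h (x2 s * b2 s)) in *.
      assert (Dy : forall (x : R -> R) (u' : R), is_derive x s u' ->
         is_derive (fun t => x t / (t - s0)) s ((u' - x s / (s - s0)) / (s - s0))).
      { intros x u' Hd.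
        assert (Dt : is_derive (fun t => t - s0) s 1) by (auto_derive; auto).
        assert (Dq := is_derive_div _ _ s _ _ Hd Dt Hrs). cbv beta in Dq.
        match type of Dq with is_derive _ _ ?d =>
          replace ((u' - x s / (s - s0)) / (s - s0)) with d; [exact Dq|] end.
        field. lra. }
      assert (Dy1 := Dy x1 _ (proj1 G1)). assert (Dy2 := Dy x2 _ (proj1 G2)).
      change (fun t => x1 t / (t - s0)) with y1 in Dy1. change (fun t => x2 t / (t - s0)) with y2 in Dy2.
      fold (y1 s) in Dy1. fold (y2 s) in Dy2.
      exists (2 * (y1 s - y2 s) * ((u1 s - y1 s) / (s - s0) - (u2 s - y2 s) / (s - s0))
              + K * (2 * (w1 s - w2 s) * (2 * (u1 s / x1 s) * (g1 - w1 s) - 2 * (u2 s / x2 s) * (g2 - w2 s)))).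
      split.
      + apply (is_derive_plus (V := R_NormedModule) (fun s => (y1 s - y2 s) ^ 2)).
        * apply is_derive_sqr_diff; assumption.
        * apply (is_derive_scal (fun s => (w1 s - w2 s) ^ 2)). apply is_derive_sqr_diff; assumption.
      + rewrite !Rmult_0_l.
        replace ((s - s0) * (2 * (y1 s - y2 s) * ((u1 s - y1 s) / (s - s0) - (u2 s - y2 s) / (s - s0))
              + K * (2 * (w1 s - w2 s) * (2 * (u1 s / x1 s) * (g1 - w1 s) - 2 * (u2 s / x2 s) * (g2 - w2 s)))))
        with (2 * (y1 s - y2 s) * ((u1 s - u2 s) - (y1 s - y2 s))
              + K * (2 * (w1 s - w2 s) * (2 * (a1 s * ((g1 - g2) - (w1 s - w2 s)) + (a1 s - a2 s) * (g2 - w2 s))))).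
        2: { unfold a1, a2. rewrite Hx1, Hx2. field. repeat split; auto. }
        apply axis_energy_decay with (Lu := Lu) (La := La) (e := e); auto.
        * unfold D in A1. rewrite A6 in A1. eapply Rle_trans; [exact A1|].
          rewrite Rmult_plus_distr_l. apply Rplus_le_compat_l.
          pose proof (Rabs_pos (y1 s - y2 s)).
          assert (Lu * Rabs (s - s0) <= / 4); [|nra].
          apply Rle_trans with (Lu * / (4 * (Lu + 1))). { apply Rmult_le_compat_l; auto. }
          apply Rmult_le_reg_r with (4 * (Lu + 1)); [lra|].
          rewrite Rmult_assoc, Rinv_l by lra. lra.
        * apply Rabs_def2 in A8. lra.
    - assert (LE : filterlim E F (locally ((u1 s0 - u1 s0) ^ 2 + K * (h 0 - h 0) ^ 2))).
      { assert (CE : lip_close F D2 ((u1 s0 - u1 s0) ^ 2 + K * (h 0 - h 0) ^ 2) E E).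
        { assert (By1 := lip_refl F D2 _ _ Ly1). assert (By2 := lip_refl F D2 _ _ Ly2).
          assert (Bw1 := lip_refl F D2 _ _ Lw1). assert (Bw2 := lip_refl F D2 _ _ Lw2).
          unfold E. lip. }
        apply CE. }
      replace ((u1 s0 - u1 s0) ^ 2 + K * (h 0 - h 0) ^ 2) with 0 in LE by ring. exact LE. }
  assert (Hfin : F (fun s => x1 s = x2 s /\ u1 s = u2 s /\ v1 s = v2 s)).
  { generalize (filter_and _ _ (filter_and _ _ (locally_locally' _ _ flow1) (locally_locally' _ _ flow2))
      (filter_and _ _ (filter_and _ _ HE Bu) Hdx)).
    apply filter_imp. intros s ((G1 & G2) & (A1 & A2) & A3). unfold E in A1.
    pose proof (pow2_ge_0 (y1 s - y2 s)). pose proof (pow2_ge_0 (w1 s - w2 s)).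
    assert (Hyz : y1 s - y2 s = 0). { apply Rsqr_0_uniq. unfold Rsqr. nra. }
    assert (Hwz : w1 s - w2 s = 0). { apply Rsqr_0_uniq. unfold Rsqr. nra. }
    assert (Hxz : x1 s = x2 s).
    { rewrite Hyz, Rabs_R0, Rmult_0_r in A3. apply Rabs_eq_0 in A3. lra. }
    assert (Huz : u1 s = u2 s).
    { unfold D in A2. rewrite Hwz, Hxz, Rminus_diag, Rabs_R0, Rplus_0_r, Rmult_0_r in A2.
      pose proof (Rabs_pos (u1 s - u2 s)).
      assert (A4 : Rabs (u1 s - u2 s) = 0) by lra. apply Rabs_eq_0 in A4. lra. }
    repeat split; auto.
    unfold w1, w2, tilt in Hwz. rewrite Hxz, Huz in Hwz.
    destruct G2 as (_ & _ & _ & _ & W & _). assert (Hq := sqrt_lt_R0 _ W).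
    apply Rmult_eq_reg_r with (/ sqrt (area2 c0 (x2 s) (u2 s))).
    - unfold Rdiv in Hwz. lra.
    - apply Rinv_neq_0_compat. lra. }
  destruct (locally_elim _ _ Hfin) as (d & Hd & HF).
  apply locally_intro with d; auto. intros s Hs.
  destruct (Req_dec s s0) as [->|Hs0]; auto.
Qed.

End LocalUniquenessOnAxis.

(** * Global uniqueness and gluing of profiles *)

(** Connectedness of an interval. The set [P] only needs to be open and closed
    relatively to [I]. *)
Lemma interval_clopen (I P : R -> Prop) (s0 : R) :
  Defs.open_interval I -> I s0 -> P s0 ->
  (forall s, I s -> P s -> locally s P) ->
  (forall s, I s -> ~ P s -> locally s (fun y => ~ P y)) ->
  forall s, I s -> P s.
Proof.
  intros (_ & _ & HI) I0 P0 Hop Hcl s Hs.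
  assert (Main : forall e b, Rabs e = 1 -> 0 <= b -> I (s0 + e * b) -> P (s0 + e * b)).
  { intros e b He Hb Ib.
    assert (Hin : forall t, 0 <= t <= b -> I (s0 + e * t)).
    { intros t Ht. unfold Rabs in He. destruct (Rcase_abs e).
      - apply (HI (s0 + e * b) (s0 + e * t) s0); auto. nra.
      - apply (HI s0 (s0 + e * t) (s0 + e * b)); auto. nra. }
    assert (Hdist : forall t y, Rabs (s0 + e * y - (s0 + e * t)) = Rabs (y - t)).
    { intros t y. replace (s0 + e * y - (s0 + e * t)) with (e * (y - t)) by ring.
      rewrite Rabs_mult, He. ring. }
    apply (segment_induction (fun t => P (s0 + e * t)) b); auto.
    - rewrite Rmult_0_r, Rplus_0_r. exact P0.
    - intros t Ht Pt. destruct (locally_elim _ _ (Hop _ (Hin t Ht) Pt)) as (d & Hd & H).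
      apply locally_intro with d; auto. intros y Hy. apply H. rewrite Hdist. exact Hy.
    - intros t Ht Py. apply NNPP. intros Hn.
      destruct (locally_elim _ _ (Hcl _ (Hin t ltac:(lra)) Hn)) as (d & Hd & H).
      pose proof (Rmin_l d t). pose proof (Rmin_r d t).
      assert (0 < Rmin d t) by (apply Rmin_glb_lt; lra).
      apply (H (s0 + e * (t - Rmin d t / 2))).
      + rewrite Hdist. replace (t - Rmin d t / 2 - t) with (- (Rmin d t / 2)) by ring.
        rewrite Rabs_Ropp, Rabs_right; lra.
      + apply Py. lra. }
  destruct (Rle_lt_dec s0 s) as [K|K].
  - replace s with (s0 + 1 * (s - s0)) in * by ring. apply Main; auto; [apply Rabs_R1|lra].
  - replace s with (s0 + -1 * (s0 - s)) in * by ring. apply Main; auto; [|lra].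
    rewrite Rabs_left; lra.
Qed.

Definition curv (x z : R -> R) (s : R) : R :=
  Derive x s * Derive (Derive z) s - Derive z s * Derive (Derive x) s.

Definition C2_at (f : R -> R) (s : R) : Prop :=
  ex_derive f s /\ ex_derive (Derive f) s /\ continuous (Derive (Derive f)) s.

(** This is the equation for the orientation of the surface in which the normal has
    vertical component [height]; [normal_form] reduces every surface to it. *)
Definition profile_at (c0 : R) (h x z : R -> R) (s : R) : Prop :=
  C2_at x s /\ C2_at z s /\ Derive x s ^ 2 + Derive z s ^ 2 = 1 /\
  (x s = 0 -> Derive x s <> 0) /\
  curv x z s * (x s * (x s ^ 2 + c0 ^ 2)) = bending c0 h (x s) (Derive x s) (Derive z s).

Definition solution (c0 : R) (h : R -> R) (I : R -> Prop) (x z : R -> R) : Prop :=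
  Defs.open_interval I /\ forall s, I s -> profile_at c0 h x z s.

Lemma area2_pos c0 x u : c0 <> 0 -> (x = 0 -> u <> 0) -> 0 < area2 c0 x u.
Proof.
  intros Hc Hx. unfold area2. assert (0 < c0 ^ 2) by (apply pow2_gt_0; auto).
  destruct (Req_dec x 0) as [E|E].
  - assert (0 < u ^ 2) by (apply pow2_gt_0; auto). rewrite E. nra.
  - assert (0 < x ^ 2) by (apply pow2_gt_0; auto). pose proof (pow2_ge_0 u). nra.
Qed.

(** Differentiating [x'^2 + z'^2 = 1] shows that the acceleration is normal. *)
Lemma unit_speed_acceleration (x z : R -> R) (s : R) :
  ex_derive (Derive x) s -> ex_derive (Derive z) s ->
  locally s (fun t => Derive x t ^ 2 + Derive z t ^ 2 = 1) ->
  Derive (Derive x) s = - curv x z s * Derive z s /\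
  Derive (Derive z) s = curv x z s * Derive x s.
Proof.
  intros Hx Hz Hloc. assert (N := locally_singleton _ _ Hloc). cbv beta in N.
  assert (D1 : is_derive (fun t => Derive x t ^ 2 + Derive z t ^ 2) s
            (2 * Derive x s * Derive (Derive x) s + 2 * Derive z s * Derive (Derive z) s)).
  { apply (is_derive_plus (V := R_NormedModule) (fun t => Derive x t ^ 2)).
    - replace (2 * Derive x s * Derive (Derive x) s)
        with (2 * Derive (Derive x) s * Derive x s) by ring.
      replace (2 * Derive (Derive x) s * Derive x s) with (INR 2 * Derive (Derive x) s * Derive x s ^ 1) by (simpl; ring).
      apply (is_derive_pow (Derive x) 2). apply Derive_correct. exact Hx.
    - replace (2 * Derive z s * Derive (Derive z) s)
        with (INR 2 * Derive (Derive z) s * Derive z s ^ 1) by (simpl; ring).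
      apply (is_derive_pow (Derive z) 2). apply Derive_correct. exact Hz. }
  assert (D2 : is_derive (fun t => Derive x t ^ 2 + Derive z t ^ 2) s 0).
  { apply is_derive_ext_loc with (fun _ => 1).
    - revert Hloc. apply filter_imp. intros t Ht. symmetry. exact Ht.
    - apply (is_derive_const (V := R_NormedModule) 1 s). }
  assert (Z := is_derive_unique _ _ _ D1). rewrite (is_derive_unique _ _ _ D2) in Z.
  unfold curv. set (u := Derive x s) in *. set (v := Derive z s) in *.
  set (p := Derive (Derive x) s) in *. set (r := Derive (Derive z) s) in *.
  split.
  - replace (- (u * r - v * p) * v) with (p * (u ^ 2 + v ^ 2) - u * (u * p + v * r)) by ring.
    rewrite N. replace (u * p + v * r) with 0 by lra. ring.
  - replace ((u * r - v * p) * u) with (r * (u ^ 2 + v ^ 2) - v * (u * p + v * r)) by ring.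
    rewrite N. replace (u * p + v * r) with 0 by lra. ring.
Qed.

Lemma solution_flow c0 h I x z s :
  c0 <> 0 -> solution c0 h I x z -> I s ->
  locally s (flow_at c0 h x (Derive x) (Derive z) (curv x z)).
Proof.
  intros Hc ((HI & _) & Hsol) Is.
  assert (HP : forall t, I t -> locally t (profile_at c0 h x z)).
  { intros t It. generalize (HI t It). apply filter_imp. exact Hsol. }
  generalize (HI s Is). apply filter_imp. intros t It.
  destruct (Hsol t It) as ((X1 & X2 & _) & (Z1 & Z2 & _) & N & Hx & Hode).
  destruct (unit_speed_acceleration x z t X2 Z2) as [A1 A2].
  { generalize (HP t It). apply filter_imp. intros y (_ & _ & Ny & _). exact Ny. }
  split; [|split; [|split; [|split; [|split]]]]; auto.
  - apply Derive_correct. exact X1.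
  - rewrite <- A1. apply Derive_correct. exact X2.
  - rewrite <- A2. apply Derive_correct. exact Z2.
  - apply area2_pos; auto.
Qed.

Lemma flow_unique c0 h s0 x1 u1 v1 k1 x2 u2 v2 k2 :
  c0 <> 0 -> C1_m1_1 h ->
  locally s0 (flow_at c0 h x1 u1 v1 k1) ->
  locally s0 (flow_at c0 h x2 u2 v2 k2) ->
  x1 s0 = x2 s0 -> u1 s0 = u2 s0 -> v1 s0 = v2 s0 ->
  locally s0 (fun s => x1 s = x2 s /\ u1 s = u2 s /\ v1 s = v2 s).
Proof.
  intros Hc hh F1 F2 Ex Eu Ev.
  destruct (Req_dec (x1 s0) 0) as [Hx|Hx].
  - apply (flow_unique_on_axis c0 h s0 Hc hh x1 u1 v1 k1 x2 u2 v2 k2); auto.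
    intros Hu. destruct (locally_singleton _ _ F1) as (_ & _ & _ & _ & W & _).
    unfold area2 in W. rewrite Hx, Hu in W. nra.
  - apply (flow_unique_off_axis c0 h s0 Hc hh x1 u1 v1 k1 x2 u2 v2 k2); auto.
Qed.

(** On the axis, [tilt_on_axis] gives the slope [v / u] and the unit length then
    gives [u]. *)
Lemma initial_direction c0 h x u v k s0 :
  c0 <> 0 -> flow_at c0 h x u v k s0 -> x s0 = 0 -> 0 < u s0 ->
  u s0 = / sqrt (1 + c0 ^ 2 * h 0 ^ 2) /\ v s0 = Rabs c0 * h 0 * u s0.
Proof.
  intros Hc F Hx Hu. assert (T := tilt_on_axis _ _ _ _ _ _ _ F Hx).
  destruct F as (_ & _ & _ & N & W & _).
  assert (Hq : sqrt (area2 c0 (x s0) (u s0)) = Rabs c0 * u s0).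
  { unfold area2. rewrite Hx. replace (c0 ^ 2 * u s0 ^ 2 + 0 ^ 2) with (Rsqr (c0 * u s0)) by (unfold Rsqr; ring).
    rewrite sqrt_Rsqr_abs, Rabs_mult, (Rabs_right (u s0)); lra. }
  assert (Hcp := Rabs_pos_lt _ Hc).
  assert (Hv : v s0 = Rabs c0 * h 0 * u s0).
  { rewrite <- T. unfold tilt. rewrite Hq. field. split; lra. }
  split; auto.
  assert (N' : u s0 ^ 2 * (1 + c0 ^ 2 * h 0 ^ 2) = 1).
  { rewrite <- N at 2. rewrite Hv, <- (pow2_abs c0). ring. }
  assert (Hp : 0 < 1 + c0 ^ 2 * h 0 ^ 2).
  { pose proof (pow2_ge_0 (c0 * h 0)). rewrite Rpow_mult_distr in H. lra. }
  assert (Hs := sqrt_lt_R0 _ Hp). assert (Hss := sqrt_sqrt _ (Rlt_le _ _ Hp)).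
  set (q := sqrt (1 + c0 ^ 2 * h 0 ^ 2)) in *. rewrite <- Hss in N'.
  apply Rmult_eq_reg_r with q; [|lra]. rewrite Rinv_l by lra.
  assert (0 < u s0 * q) by nra.
  assert ((u s0 * q - 1) * (u s0 * q + 1) = 0) by nra.
  apply Rmult_integral in H0. destruct H0; lra.
Qed.

Definition axial_start (I : R -> Prop) (x z : R -> R) : Prop :=
  I 0 /\ x 0 = 0 /\ 0 < Derive x 0 /\ z 0 = 0.

(** The points where position and tangent agree form a closed set by continuity
    and an open set by [flow_unique]. *)
Lemma solutions_agree c0 h I1 x1 z1 I2 x2 z2 :
  c0 <> 0 -> C1_m1_1 h ->
  solution c0 h I1 x1 z1 -> axial_start I1 x1 z1 ->
  solution c0 h I2 x2 z2 -> axial_start I2 x2 z2 ->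
  forall s, I1 s -> I2 s -> x1 s = x2 s /\ z1 s = z2 s.
Proof.
  intros Hc hh S1 (O1 & X1 & U1 & Z1) S2 (O2 & X2 & U2 & Z2).
  set (J := fun s => I1 s /\ I2 s).
  assert (HJ : Defs.open_interval J).
  { destruct S1 as ((A1 & _ & B1) & _). destruct S2 as ((A2 & _ & B2) & _).
    split; [|split].
    - apply open_and; auto.
    - exists 0. split; auto.
    - intros a b c (Ja & Ja') (Jc & Jc') Hb. split; [apply (B1 a b c)|apply (B2 a b c)]; auto. }
  set (P := fun s => x1 s = x2 s /\ Derive x1 s = Derive x2 s /\ Derive z1 s = Derive z2 s).
  assert (HP : forall s, J s -> P s).
  { apply (interval_clopen J P 0); auto.
    - split; auto.
    - destruct (initial_direction c0 h x1 (Derive x1) (Derive z1) (curv x1 z1) 0) as [A1 A2]; auto.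
      { apply (locally_singleton _ _ (solution_flow c0 h I1 x1 z1 0 Hc S1 O1)). }
      destruct (initial_direction c0 h x2 (Derive x2) (Derive z2) (curv x2 z2) 0) as [B1 B2]; auto.
      { apply (locally_singleton _ _ (solution_flow c0 h I2 x2 z2 0 Hc S2 O2)). }
      repeat split; congruence.
    - intros s (Js1 & Js2) (E1 & E2 & E3).
      apply (flow_unique c0 h s x1 _ _ (curv x1 z1) x2 _ _ (curv x2 z2)); auto.
      + apply (solution_flow c0 h I1); auto.
      + apply (solution_flow c0 h I2); auto.
    - intros s (Js1 & Js2) Hn.
      destruct S1 as (_ & S1). destruct S2 as (_ & S2).
      destruct (S1 s Js1) as ((X11 & X12 & _) & (_ & Z12 & _) & _).
      destruct (S2 s Js2) as ((X21 & X22 & _) & (_ & Z22 & _) & _).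
      set (E := fun t => (x1 t - x2 t) ^ 2 + (Derive x1 t - Derive x2 t) ^ 2
                         + (Derive z1 t - Derive z2 t) ^ 2).
      assert (HE : exists l, is_derive E s l).
      { eexists. apply (is_derive_plus (V := R_NormedModule)
          (fun t => (x1 t - x2 t) ^ 2 + (Derive x1 t - Derive x2 t) ^ 2)).
        apply (is_derive_plus (V := R_NormedModule) (fun t => (x1 t - x2 t) ^ 2)).
        all: apply is_derive_sqr_diff; apply Derive_correct; assumption. }
      destruct HE as [l HE].
      assert (Hpos : 0 < E s).
      { apply Rnot_le_lt. intros Hle. apply Hn.
        unfold E in Hle. pose proof (pow2_ge_0 (x1 s - x2 s)).
        pose proof (pow2_ge_0 (Derive x1 s - Derive x2 s)).
        pose proof (pow2_ge_0 (Derive z1 s - Derive z2 s)).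
        destruct (sq_sum_zero (x1 s - x2 s) (Derive x1 s - Derive x2 s) (Derive z1 s - Derive z2 s)) as (K1 & K2 & K3); [lra|].
        unfold P. lra. }
      generalize (lim_near _ _ _ (is_derive_filterlim _ _ _ HE) _ Hpos). apply filter_imp.
      intros t Ht (K1 & K2 & K3). unfold E at 1 in Ht. rewrite K1, K2, K3 in Ht.
      apply Rabs_def2 in Ht. nra. }
  intros s Js1 Js2. assert (Js : J s) by (split; auto).
  split; [apply HP; auto|].
  destruct HJ as (_ & _ & HJ).
  assert (J0 : J 0) by (split; auto).
  assert (Hin : forall t, Rmin 0 s <= t <= Rmax 0 s -> J t).
  { intros t Ht. unfold Rmin, Rmax in Ht. destruct (Rle_dec 0 s).
    - apply (HJ 0 t s); auto.
    - apply (HJ s t 0); auto. }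
  assert (HD : forall t, J t -> is_derive (fun t => z1 t - z2 t) t 0).
  { intros t Jt. destruct (HP t Jt) as (_ & _ & E). destruct Jt as (Jt1 & Jt2).
    destruct S1 as (_ & S1). destruct S2 as (_ & S2).
    destruct (S1 t Jt1) as (_ & (Zt1 & _) & _).
    destruct (S2 t Jt2) as (_ & (Zt2 & _) & _).
    replace 0 with (minus (Derive z1 t) (Derive z2 t)) by (rewrite E; apply Rminus_diag).
    apply (is_derive_minus (V := R_NormedModule) z1 z2); apply Derive_correct; assumption. }
  destruct (MVT_gen (fun t => z1 t - z2 t) 0 s (fun _ => 0)) as (c & _ & Hz).
  - intros t Ht. apply HD, Hin. lra.
  - intros t Ht. apply continuity_pt_filterlim. apply (is_derive_filterlim (fun t => z1 t - z2 t) t 0). apply HD, Hin. lra.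
  - cbv beta in Hz. lra.
Qed.

Lemma C2_at_ext f g s : locally s (fun t => f t = g t) -> C2_at f s -> C2_at g s.
Proof.
  intros He (H1 & H2 & H3).
  assert (He1 : locally s (fun t => Derive f t = Derive g t)).
  { generalize (locally_locally _ _ He). apply filter_imp. intros t Ht. apply Derive_ext_loc. exact Ht. }
  assert (He2 : locally s (fun t => Derive (Derive f) t = Derive (Derive g) t)).
  { generalize (locally_locally _ _ He1). apply filter_imp. intros t Ht. apply Derive_ext_loc. exact Ht. }
  repeat split.
  - apply ex_derive_ext_loc with f; auto.
  - apply ex_derive_ext_loc with (Derive f); auto.
  - apply continuous_ext_loc with (Derive (Derive f)); auto.
Qed.

Lemma profile_at_ext c0 h x z y w s :
  locally s (fun t => x t = y t) -> locally s (fun t => z t = w t) ->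
  profile_at c0 h x z s -> profile_at c0 h y w s.
Proof.
  intros Hx Hz (P1 & P2 & P3 & P4 & P5).
  assert (D1 : locally s (fun t => Derive x t = Derive y t)).
  { generalize (locally_locally _ _ Hx). apply filter_imp. intros t Ht. apply Derive_ext_loc. exact Ht. }
  assert (D2 : locally s (fun t => Derive z t = Derive w t)).
  { generalize (locally_locally _ _ Hz). apply filter_imp. intros t Ht. apply Derive_ext_loc. exact Ht. }
  assert (DD1 := Derive_ext_loc _ _ _ D1). assert (DD2 := Derive_ext_loc _ _ _ D2).
  apply locally_singleton in D1. apply locally_singleton in D2.
  assert (Ex := locally_singleton _ _ Hx). cbv beta in *.
  split; [|split; [|split; [|split]]].
  - apply (C2_at_ext x); auto.
  - apply (C2_at_ext z); auto.
  - rewrite <- D1, <- D2. exact P3.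
  - rewrite <- Ex, <- D1. exact P4.
  - unfold curv in *. rewrite <- D1, <- D2, <- Ex, <- DD1, <- DD2. exact P5.
Qed.

Definition glue (I : R -> Prop) (f g : R -> R) (s : R) : R :=
  if excluded_middle_informative (I s) then f s else g s.

Lemma glue_left I f g s : I s -> glue I f g s = f s.
Proof. intros H. unfold glue. destruct (excluded_middle_informative (I s)); tauto. Qed.

Lemma glue_right (I I' : R -> Prop) f g s :
  (forall t, I t -> I' t -> f t = g t) -> I' s -> glue I f g s = g s.
Proof.
  intros H Hs. unfold glue. destruct (excluded_middle_informative (I s)); auto.
Qed.

Lemma open_interval_union I1 I2 s0 :
  Defs.open_interval I1 -> Defs.open_interval I2 -> I1 s0 -> I2 s0 ->
  Defs.open_interval (fun s => I1 s \/ I2 s).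
Proof.
  intros (A1 & _ & B1) (A2 & _ & B2) S1 S2. split; [|split].
  - apply open_or; auto.
  - exists s0. auto.
  - intros a b c Ha Hc Hb. destruct (Rle_lt_dec b s0).
    + destruct Ha; [left; apply (B1 a b s0)|right; apply (B2 a b s0)]; auto; lra.
    + destruct Hc; [left; apply (B1 s0 b c)|right; apply (B2 s0 b c)]; auto; lra.
Qed.

Lemma solution_glue c0 h I1 x1 z1 I2 x2 z2 s0 :
  solution c0 h I1 x1 z1 -> solution c0 h I2 x2 z2 -> I1 s0 -> I2 s0 ->
  (forall s, I1 s -> I2 s -> x1 s = x2 s /\ z1 s = z2 s) ->
  solution c0 h (fun s => I1 s \/ I2 s) (glue I1 x1 x2) (glue I1 z1 z2).
Proof.
  intros (A1 & S1) (A2 & S2) O1 O2 Hag.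
  split; [apply (open_interval_union I1 I2 s0); auto|].
  destruct A1 as (A1 & _). destruct A2 as (A2 & _).
  intros s [Is|Is].
  - apply (profile_at_ext c0 h x1 z1); auto.
    + generalize (A1 s Is). apply filter_imp. intros t It. symmetry. apply glue_left. auto.
    + generalize (A1 s Is). apply filter_imp. intros t It. symmetry. apply glue_left. auto.
  - apply (profile_at_ext c0 h x2 z2); auto.
    + generalize (A2 s Is). apply filter_imp. intros t It. symmetry.
      apply (glue_right I1 I2); auto. intros; apply Hag; auto.
    + generalize (A2 s Is). apply filter_imp. intros t It. symmetry.
      apply (glue_right I1 I2); auto. intros; apply Hag; auto.
Qed.

(** * Fundamental forms and normals of helicoidal surfaces *)

Section FundamentalForms.

Variables (c0 : R) (x z : R -> R).

Lemma pd1_helicoidal s t : ex_derive z s ->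
  pd1 (helicoidal_param c0 x z) s t = (Derive x s * cos t, Derive x s * sin t, Derive z s).
Proof.
  intros Hz. unfold pd1, Derive_R3, helicoidal_param, crd1, crd2, crd3. simpl.
  f_equal; [f_equal|].
  - apply Derive_scal_l.
  - apply Derive_scal_l.
  - rewrite (Derive_plus z (fun _ => c0 * t)); [|exact Hz|apply ex_derive_const].
    rewrite Derive_const. ring.
Qed.

Lemma pd2_helicoidal s t :
  pd2 (helicoidal_param c0 x z) s t = (- x s * sin t, x s * cos t, c0).
Proof.
  unfold pd2, Derive_R3, helicoidal_param, crd1, crd2, crd3. simpl.
  f_equal; [f_equal|]; apply is_derive_unique; auto_derive; auto; ring.
Qed.

Lemma pd11_helicoidal s t : locally s (ex_derive z) ->
  pd1 (pd1 (helicoidal_param c0 x z)) s t =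
  (Derive (Derive x) s * cos t, Derive (Derive x) s * sin t, Derive (Derive z) s).
Proof.
  intros Hz. unfold pd1 at 1. unfold Derive_R3.
  assert (L : locally s (fun u => pd1 (helicoidal_param c0 x z) u t =
              (Derive x u * cos t, Derive x u * sin t, Derive z u))).
  { revert Hz. apply filter_imp. intros u Hu. apply pd1_helicoidal. exact Hu. }
  f_equal; [f_equal|].
  - rewrite (Derive_ext_loc _ (fun u => Derive x u * cos t)); [apply Derive_scal_l|].
    revert L. apply filter_imp. intros u ->. reflexivity.
  - rewrite (Derive_ext_loc _ (fun u => Derive x u * sin t)); [apply Derive_scal_l|].
    revert L. apply filter_imp. intros u ->. reflexivity.
  - apply (Derive_ext_loc _ (Derive z)).
    revert L. apply filter_imp. intros u ->. reflexivity.
Qed.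

Lemma pd21_helicoidal s t : ex_derive z s ->
  pd2 (pd1 (helicoidal_param c0 x z)) s t = (- Derive x s * sin t, Derive x s * cos t, 0).
Proof.
  intros Hz. unfold pd2, Derive_R3.
  f_equal; [f_equal|].
  - rewrite (Derive_ext _ (fun t => Derive x s * cos t)).
    + apply is_derive_unique. auto_derive; auto; ring.
    + intros y. rewrite pd1_helicoidal by exact Hz. reflexivity.
  - rewrite (Derive_ext _ (fun t => Derive x s * sin t)).
    + apply is_derive_unique. auto_derive; auto; ring.
    + intros y. rewrite pd1_helicoidal by exact Hz. reflexivity.
  - rewrite (Derive_ext _ (fun t => Derive z s)).
    + apply Derive_const.
    + intros y. rewrite pd1_helicoidal by exact Hz. reflexivity.
Qed.

Lemma pd22_helicoidal s t :
  pd2 (pd2 (helicoidal_param c0 x z)) s t = (- x s * cos t, - x s * sin t, 0).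
Proof.
  unfold pd2 at 1. unfold Derive_R3.
  f_equal; [f_equal|].
  - rewrite (Derive_ext _ (fun t => - x s * sin t)).
    + apply is_derive_unique. auto_derive; auto; ring.
    + intros y. rewrite pd2_helicoidal. reflexivity.
  - rewrite (Derive_ext _ (fun t => x s * cos t)).
    + apply is_derive_unique. auto_derive; auto; ring.
    + intros y. rewrite pd2_helicoidal. reflexivity.
  - rewrite (Derive_ext _ (fun t => c0)).
    + apply Derive_const.
    + intros y. rewrite pd2_helicoidal. reflexivity.
Qed.

Lemma cos2_sin2 t : cos t * cos t = 1 - sin t * sin t.
Proof. pose proof (sin2_cos2 t). unfold Rsqr in H. lra. Qed.

Lemma mean_curvature_helicoidal (eta : R -> R -> R3) s t (n m c : R) :
  locally s (ex_derive z) ->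
  Derive x s ^ 2 + Derive z s ^ 2 = 1 ->
  n = cos t * crd1 (eta s t) + sin t * crd2 (eta s t) ->
  m = - sin t * crd1 (eta s t) + cos t * crd2 (eta s t) ->
  c = crd3 (eta s t) ->
  mean_curvature (helicoidal_param c0 x z) eta s t =
  ((Derive (Derive x) s * n + Derive (Derive z) s * c) * (x s ^ 2 + c0 ^ 2)
   - 2 * c0 * Derive x s * Derive z s * m - x s * n)
  / (2 * area2 c0 (x s) (Derive x s)).
Proof.
  intros Hz N Hn Hm Hc.
  assert (Hzs := locally_singleton _ _ Hz). cbv beta in Hzs.
  unfold mean_curvature.
  rewrite pd11_helicoidal, pd21_helicoidal, pd22_helicoidal, pd1_helicoidal, pd2_helicoidal by assumption.
  unfold dot. rewrite Hn, Hm, Hc. clear Hn Hm Hc n m c.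
  generalize (crd1 (eta s t)) (crd2 (eta s t)) (crd3 (eta s t)). intros a b c.
  unfold crd1, crd2, crd3. simpl fst. simpl snd.
  set (u := Derive x s) in *. set (v := Derive z s) in *. set (p := Derive (Derive x) s). set (r := Derive (Derive z) s).
  assert (HE : u * cos t * (u * cos t) + u * sin t * (u * sin t) + v * v = 1).
  { rewrite <- N. replace (u * cos t * (u * cos t)) with (u * u * (cos t * cos t)) by ring.
    rewrite cos2_sin2. ring. }
  assert (HF : u * cos t * (- x s * sin t) + u * sin t * (x s * cos t) + v * c0 = c0 * v) by ring.
  assert (HG : - x s * sin t * (- x s * sin t) + x s * cos t * (x s * cos t) + c0 * c0 = x s ^ 2 + c0 ^ 2).
  { replace (x s * cos t * (x s * cos t)) with (x s * x s * (cos t * cos t)) by ring.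
    rewrite cos2_sin2. ring. }
  rewrite HE, HF, HG. unfold area2. f_equal.
  - ring.
  - f_equal. replace (u ^ 2) with (1 - v ^ 2) by lra. ring.
Qed.

End FundamentalForms.

(** A unit vector with radial, angular and vertical components [(n, m, c)] that is
    orthogonal to the coordinate fields of the surface is one of the two unit
    normals; [e] is its scalar product with the reference normal. *)
Lemma unit_normal_components (c0 x u v n m c : R) :
  u ^ 2 + v ^ 2 = 1 -> 0 < area2 c0 x u ->
  u * n + v * c = 0 -> x * m + c0 * c = 0 -> n ^ 2 + m ^ 2 + c ^ 2 = 1 ->
  let q := sqrt (area2 c0 x u) in
  let e := (- v * x * n - c0 * u * m + x * u * c) / q in
  e ^ 2 = 1 /\ n = - e * (v * x / q) /\ m = - e * (c0 * u / q) /\ c = e * (x * u / q).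
Proof.
  intros N W O1 O2 L q e.
  assert (Hq := sqrt_lt_R0 _ W). assert (Hqq := sqrt_sqrt _ (Rlt_le _ _ W)). fold q in Hq, Hqq.
  set (T := - v * n + u * c).
  assert (Hn : n = - v * T).
  { unfold T. replace (- v * (- v * n + u * c)) with (n * (u ^ 2 + v ^ 2) - u * (u * n + v * c)) by ring.
    rewrite N, O1. ring. }
  assert (Hc : c = u * T).
  { unfold T. replace (u * (- v * n + u * c)) with (c * (u ^ 2 + v ^ 2) - v * (u * n + v * c)) by ring.
    rewrite N, O1. ring. }
  assert (He : e * q = x * T - c0 * u * m). { unfold e, T. field. lra. }
  assert (O3 : x * m + c0 * u * T = 0) by (rewrite <- O2, Hc; ring).
  assert (Hm : m * (q * q) = - (c0 * u) * (e * q)).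
  { rewrite He, Hqq. unfold area2.
    replace (m * (c0 ^ 2 * u ^ 2 + x ^ 2)) with (c0 ^ 2 * u ^ 2 * m + x * (x * m)) by ring.
    replace (x * m) with (- (c0 * u * T)) by lra. ring. }
  assert (HT : T * (q * q) = x * (e * q)).
  { rewrite He, Hqq. unfold area2.
    replace (T * (c0 ^ 2 * u ^ 2 + x ^ 2)) with (x ^ 2 * T + c0 * u * (c0 * u * T)) by ring.
    replace (c0 * u * T) with (- (x * m)) by lra. ring. }
  assert (Hm' : m = - e * (c0 * u / q)).
  { apply Rmult_eq_reg_r with (q * q); [|nra]. rewrite Hm. field. lra. }
  assert (HT' : T = e * (x / q)).
  { apply Rmult_eq_reg_r with (q * q); [|nra]. rewrite HT. field. lra. }
  repeat split.
  - assert (LT : T ^ 2 + m ^ 2 = 1).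
    { rewrite <- L. rewrite Hn, Hc. replace ((- v * T) ^ 2 + m ^ 2 + (u * T) ^ 2) with (T ^ 2 * (u ^ 2 + v ^ 2) + m ^ 2) by ring.
      rewrite N. ring. }
    rewrite <- LT, Hm', HT'. 
    replace ((e * (x / q)) ^ 2 + (- e * (c0 * u / q)) ^ 2) with (e ^ 2 * ((c0 ^ 2 * u ^ 2 + x ^ 2) / (q * q))) by (field; lra).
    rewrite Hqq. fold (area2 c0 x u). field. lra.
  - rewrite Hn, HT'. field. lra.
  - exact Hm'.
  - rewrite Hc, HT'. field. lra.
Qed.

Lemma mean_curvature_normal (c0 : R) (x z : R -> R) (eta : R -> R -> R3) s t (e : R) :
  locally s (ex_derive z) ->
  Derive x s ^ 2 + Derive z s ^ 2 = 1 ->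
  let W := area2 c0 (x s) (Derive x s) in
  0 < W ->
  cos t * crd1 (eta s t) + sin t * crd2 (eta s t) = - e * (Derive z s * x s / sqrt W) ->
  - sin t * crd1 (eta s t) + cos t * crd2 (eta s t) = - e * (c0 * Derive x s / sqrt W) ->
  crd3 (eta s t) = e * (x s * Derive x s / sqrt W) ->
  mean_curvature (helicoidal_param c0 x z) eta s t * (2 * (W * sqrt W)) =
  e * (curv x z s * (x s * (x s ^ 2 + c0 ^ 2)) + 2 * c0 ^ 2 * Derive x s ^ 2 * Derive z s
       + x s ^ 2 * Derive z s).
Proof.
  intros Hz N W HW Hn Hm Hc.
  rewrite (mean_curvature_helicoidal c0 x z eta s t _ _ _ Hz N eq_refl eq_refl eq_refl).
  rewrite Hn, Hm, Hc. fold W. unfold curv.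
  assert (Hq := sqrt_lt_R0 _ HW). field. split; lra.
Qed.

Lemma continuous_pair {U V1 V2 : UniformSpace} (f : U -> V1) (g : U -> V2) (a : U) :
  continuous f a -> continuous g a -> continuous (fun y => (f y, g y)) a.
Proof.
  intros Hf Hg P [e He].
  assert (A1 : locally a (fun y => ball (f a) e (f y))) by (apply Hf, locally_ball).
  assert (A2 : locally a (fun y => ball (g a) e (g y))) by (apply Hg, locally_ball).
  unfold filtermap. generalize (filter_and _ _ A1 A2).
  apply filter_imp. intros y (Y1 & Y2). apply He. split; assumption.
Qed.

(** The unit normal whose vertical component is [height]. *)
Definition normal_param (c0 : R) (x z : R -> R) (s t : R) : R3 :=
  ((c0 * sin t * Derive x s - cos t * (Derive z s * x s)) / sqrt (area2 c0 (x s) (Derive x s)),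
   (- sin t * (x s * Derive z s) - c0 * cos t * Derive x s) / sqrt (area2 c0 (x s) (Derive x s)),
   x s * Derive x s / sqrt (area2 c0 (x s) (Derive x s))).

Definition orbit (c0 : R) (I : R -> Prop) (x z : R -> R) (p : R3) : Prop :=
  exists s t, I s /\ p = helicoidal_param c0 x z s t.

Lemma continuous_fst_comp (f : R -> R) (s t : R) :
  continuous f s -> continuous (fun y : R * R => f (fst y)) (s, t).
Proof. intros Hf. apply (continuous_comp fst f). apply continuous_fst. exact Hf. Qed.

Lemma continuous_snd_comp (f : R -> R) (s t : R) :
  continuous f t -> continuous (fun y : R * R => f (snd y)) (s, t).
Proof. intros Hf. apply (continuous_comp snd f). apply continuous_snd. exact Hf. Qed.

Lemma solution_surface c0 h I x z :
  c0 <> 0 -> solution c0 h I x z ->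
  helicoidal_H_surface (fun v => h (dot v e3)) c0 (orbit c0 I x z).
Proof.
  intros Hc (HI & Hsol).
  assert (Hex : forall s, I s -> locally s (ex_derive z)).
  { intros s Is. generalize (proj1 HI s Is). apply filter_imp. intros y Iy.
    destruct (Hsol y Iy) as (_ & (Z & _) & _). exact Z. }
  exists I, x, z, (normal_param c0 x z). split; [exact HI|]. split; [|split; [|split]].
  - split; [|split; [|split]].
    + intros s Is. apply (Hsol s Is).
    + intros s Is. apply (Hsol s Is).
    + intros s Is. apply (Hsol s Is).
    + intros s Is. apply (Hsol s Is).
  - intros s t Is. destruct (Hsol s Is) as ((X1 & X2 & _) & (Z1 & Z2 & _) & N & Hx & _).
    assert (W := area2_pos c0 _ _ Hc Hx).
    assert (Hq := sqrt_lt_R0 _ W). assert (Hqq := sqrt_sqrt _ (Rlt_le _ _ W)).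
    split; [|split; [|split]].
    + assert (Cx : continuous (fun y : R * R => x (fst y)) (s, t)).
      { apply continuous_fst_comp. apply (ex_derive_continuous x). exact X1. }
      assert (Cu : continuous (fun y : R * R => Derive x (fst y)) (s, t)).
      { apply continuous_fst_comp. apply (ex_derive_continuous (Derive x)). exact X2. }
      assert (Cv : continuous (fun y : R * R => Derive z (fst y)) (s, t)).
      { apply continuous_fst_comp. apply (ex_derive_continuous (Derive z)). exact Z2. }
      assert (Cc : continuous (fun y : R * R => cos (snd y)) (s, t)).
      { apply continuous_snd_comp. apply continuous_cos. }
      assert (Cs : continuous (fun y : R * R => sin (snd y)) (s, t)).
      { apply continuous_snd_comp. apply continuous_sin. }
      assert (K : forall c : R, continuous (fun _ : R * R => c) (s, t)) by (intros; apply continuous_const).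
      assert (M : forall f g : R * R -> R, continuous f (s, t) -> continuous g (s, t) ->
                  continuous (fun y => f y * g y) (s, t)).
      { intros f g. apply (continuous_mult (K := R_AbsRing)). }
      assert (A : forall f g : R * R -> R, continuous f (s, t) -> continuous g (s, t) ->
                  continuous (fun y => f y + g y) (s, t)).
      { intros f g. apply (continuous_plus (V := R_NormedModule)). }
      assert (S : forall f g : R * R -> R, continuous f (s, t) -> continuous g (s, t) ->
                  continuous (fun y => f y - g y) (s, t)).
      { intros f g. apply (continuous_minus (V := R_NormedModule)). }
      assert (O : forall f : R * R -> R, continuous f (s, t) ->
                  continuous (fun y => - f y) (s, t)).
      { intros f. apply (continuous_opp (V := R_NormedModule)). }
      assert (Ci : continuous (fun y : R * R => / sqrt (area2 c0 (x (fst y)) (Derive x (fst y)))) (s, t)).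
      { apply (continuous_fst_comp (fun y => / sqrt (area2 c0 (x y) (Derive x y)))).
        apply continuous_comp with (f := fun y => sqrt (area2 c0 (x y) (Derive x y))) (g := Rinv).
        - apply continuous_comp with (f := fun y => area2 c0 (x y) (Derive x y)) (g := sqrt).
          + apply (ex_derive_continuous (fun y => area2 c0 (x y) (Derive x y))).
            unfold area2. auto_derive. auto.
          + apply continuous_sqrt.
        - apply continuous_Rinv. lra. }
      unfold normal_param, Rdiv. apply continuous_pair; [apply continuous_pair|];
        apply M; auto.
    + unfold dot, normal_param, crd1, crd2, crd3. simpl fst. simpl snd.
      set (q := sqrt (area2 c0 (x s) (Derive x s))) in *.
      set (u := Derive x s) in *. set (v := Derive z s) in *.
      match goal with |- ?g = 1 => replace g with
        ((c0 ^ 2 * u ^ 2 + v ^ 2 * x s ^ 2 + (x s * u) ^ 2) / (q * q)) end.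
      * rewrite Hqq. unfold area2 in *. replace (v ^ 2) with (1 - u ^ 2) by lra. field. lra.
      * pose proof (sin2_cos2 t) as T. unfold Rsqr in T.
        replace (c0 ^ 2 * u ^ 2 + v ^ 2 * x s ^ 2) with ((c0 ^ 2 * u ^ 2 + v ^ 2 * x s ^ 2) * (sin t * sin t + cos t * cos t)) by (rewrite T; ring).
        field. lra.
    + rewrite pd1_helicoidal by exact Z1.
      unfold dot, normal_param, crd1, crd2, crd3. simpl fst. simpl snd.
      set (q := sqrt (area2 c0 (x s) (Derive x s))) in *.
      replace (Derive z s) with (Derive z s * (sin t * sin t + cos t * cos t)) at 3.
      2: { pose proof (sin2_cos2 t) as T. unfold Rsqr in T. rewrite T. ring. }
      field. lra.
    + rewrite pd2_helicoidal.
      unfold dot, normal_param, crd1, crd2, crd3. simpl fst. simpl snd.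
      set (q := sqrt (area2 c0 (x s) (Derive x s))) in *.
      replace (x s * Derive x s / q * c0) with (x s * Derive x s / q * c0 * (sin t * sin t + cos t * cos t)).
      2: { pose proof (sin2_cos2 t) as T. unfold Rsqr in T. rewrite T. ring. }
      field. lra.
  - intros s t Is. destruct (Hsol s Is) as (_ & _ & N & Hx & Hode).
    assert (W := area2_pos c0 _ _ Hc Hx).
    assert (Hq := sqrt_lt_R0 _ W).
    pose proof (sin2_cos2 t) as T. unfold Rsqr in T.
    assert (MC := mean_curvature_normal c0 x z (normal_param c0 x z) s t 1 (Hex s Is) N W).
    assert (E3 : crd3 (normal_param c0 x z s t) = 1 * height c0 (x s) (Derive x s)).
    { unfold normal_param, crd3, height. simpl. ring. }
    rewrite Hode in MC. unfold bending in MC.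
    apply Rmult_eq_reg_r with (2 * (area2 c0 (x s) (Derive x s) * sqrt (area2 c0 (x s) (Derive x s)))).
    2: { apply Rgt_not_eq. repeat apply Rmult_gt_0_compat; lra. }
    rewrite MC.
    + unfold dot. rewrite E3. unfold crd1, crd2, crd3, e3. simpl fst. simpl snd.
      rewrite !Rmult_0_r, Rmult_1_r, !Rplus_0_l, (Rmult_1_l (height _ _ _)).
      generalize (h (height c0 (x s) (Derive x s))). intros k. ring.
    + unfold normal_param, crd1, crd2, crd3. simpl fst. simpl snd.
      replace (Derive z s * x s) with (Derive z s * x s * (sin t * sin t + cos t * cos t)) at 2 by (rewrite T; ring).
      field. lra.
    + unfold normal_param, crd1, crd2, crd3. simpl fst. simpl snd.
      replace (c0 * Derive x s) with (c0 * Derive x s * (sin t * sin t + cos t * cos t)) at 1 by (rewrite T; ring).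
      field. lra.
    + exact E3.
  - intros p. reflexivity.
Qed.

(** * Normal form of a surface that meets the axis *)

(** Along [t = 0] the given normal field is the reference normal up to a sign,
    which is a continuous function on an interval and hence constant. *)
Lemma surface_equation c0 h I x z eta :
  c0 <> 0 -> Defs.open_interval I -> profile_curve I x z ->
  gauss_map (fun s _ => I s) (helicoidal_param c0 x z) eta ->
  (forall s t, I s -> mean_curvature (helicoidal_param c0 x z) eta s t = h (dot (eta s t) e3)) ->
  exists e, (e = 1 \/ e = -1) /\ forall s, I s ->
    e * (curv x z s * (x s * (x s ^ 2 + c0 ^ 2)) + 2 * c0 ^ 2 * Derive x s ^ 2 * Derive z s
         + x s ^ 2 * Derive z s) =
    2 * (area2 c0 (x s) (Derive x s) * sqrt (area2 c0 (x s) (Derive x s))) *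
    h (e * height c0 (x s) (Derive x s)).
Proof.
  intros Hc HI (Cx & Cz & N & Hx) Hg Hm.
  set (q := fun s => sqrt (area2 c0 (x s) (Derive x s))).
  set (e := fun s => (- Derive z s * x s * crd1 (eta s 0) - c0 * Derive x s * crd2 (eta s 0)
                      + x s * Derive x s * crd3 (eta s 0)) / q s).
  assert (HW : forall s, I s -> 0 < area2 c0 (x s) (Derive x s)).
  { intros s Is. apply area2_pos; auto. }
  assert (Hcomp : forall s, I s -> e s ^ 2 = 1 /\
            crd1 (eta s 0) = - e s * (Derive z s * x s / q s) /\
            crd2 (eta s 0) = - e s * (c0 * Derive x s / q s) /\
            crd3 (eta s 0) = e s * (x s * Derive x s / q s)).
  { intros s Is. destruct (Hg s 0 Is) as (_ & L & O1 & O2).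
    rewrite pd1_helicoidal in O1 by apply (Cz s Is). rewrite pd2_helicoidal in O2.
    unfold dot in L, O1, O2. rewrite cos_0, sin_0 in *.
    apply unit_normal_components; auto.
    - apply eq_trans with (2 := O1). unfold crd1, crd2, crd3. simpl fst. simpl snd. ring.
    - apply eq_trans with (2 := O2). unfold crd1, crd2, crd3. simpl fst. simpl snd. ring.
    - apply eq_trans with (2 := L). ring. }
  assert (Hcont : forall s, I s -> continuous e s).
  { intros s Is. destruct (Hg s 0 Is) as (Ce & _).
    assert (Ce0 : continuous (fun y => eta y 0) s).
    { apply (continuous_comp (fun y => (y, 0)) (fun q : R * R => eta (fst q) (snd q)));
        [|exact Ce].
      apply continuous_pair; [apply continuous_id|apply continuous_const]. }
    assert (Ce12 : continuous (fun y => fst (eta y 0)) s).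
    { apply (continuous_comp (fun y => eta y 0) (fun p : R * R * R => fst p)); auto.
      destruct (eta s 0). apply continuous_fst. }
    assert (Ce1 : continuous (fun y => crd1 (eta y 0)) s).
    { apply (continuous_comp (fun y => fst (eta y 0)) (fun p : R * R => fst p)); auto.
      destruct (fst (eta s 0)). apply continuous_fst. }
    assert (Ce2 : continuous (fun y => crd2 (eta y 0)) s).
    { apply (continuous_comp (fun y => fst (eta y 0)) (fun p : R * R => snd p)); auto.
      destruct (fst (eta s 0)). apply continuous_snd. }
    assert (Ce3 : continuous (fun y => crd3 (eta y 0)) s).
    { apply (continuous_comp (fun y => eta y 0) (fun p : R * R * R => snd p)); auto.
      destruct (eta s 0). apply continuous_snd. }
    destruct (Cx s Is) as (X1 & X2 & _). destruct (Cz s Is) as (Z1 & Z2 & _).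
    assert (B1 := lip_refl (locally s) (fun _ => 0) _ _ Ce1).
    assert (B2 := lip_refl (locally s) (fun _ => 0) _ _ Ce2).
    assert (B3 := lip_refl (locally s) (fun _ => 0) _ _ Ce3).
    assert (Bx := lip_refl (locally s) (fun _ => 0) _ _ (ex_derive_continuous _ _ X1)).
    assert (Bu := lip_refl (locally s) (fun _ => 0) _ _ (ex_derive_continuous _ _ X2)).
    assert (Bv := lip_refl (locally s) (fun _ => 0) _ _ (ex_derive_continuous _ _ Z2)).
    assert (BW : lip_close (locally s) (fun _ => 0) (area2 c0 (x s) (Derive x s))
       (fun y => area2 c0 (x y) (Derive x y)) (fun y => area2 c0 (x y) (Derive x y))).
    { unfold area2. lip. }
    assert (Bq := lip_sqrt _ _ _ _ _ (HW s Is) BW).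
    assert (Hq := sqrt_lt_R0 _ (HW s Is)).
    assert (Be : lip_close (locally s) (fun _ => 0) (e s) e e).
    { unfold e, q. apply lip_div; [typeclasses eauto|lra| |]; lip. }
    apply Be. }
  destruct HI as (HIo & (s0 & Is0) & HIc).
  assert (Hsign : forall s, I s -> e s = 1 \/ e s = -1).
  { intros s Is. destruct (Hcomp s Is) as (E & _).
    assert (Z : (e s - 1) * (e s + 1) = 0) by lra.
    apply Rmult_integral in Z. lra. }
  assert (Hstep : forall s, I s -> locally s (fun y => e y = e s)).
  { intros s Is.
    generalize (filter_and _ _ (HIo s Is) (lim_near _ _ _ (Hcont s Is) 1 Rlt_0_1)).
    apply filter_imp. intros y (Iy & Hy). apply Rabs_def2 in Hy.
    destruct (Hsign y Iy), (Hsign s Is); lra. }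
  assert (Hconst : forall s, I s -> e s = e s0).
  { apply (interval_clopen I (fun s => e s = e s0) s0); auto.
    - split; [|split]; auto. exists s0. auto.
    - intros s Is E. generalize (Hstep s Is). apply filter_imp. intros y ->. exact E.
    - intros s Is E. generalize (Hstep s Is). apply filter_imp. intros y ->. exact E. }
  exists (e s0). split; [auto|]. intros s Is.
  destruct (Hcomp s Is) as (_ & E1 & E2 & E3). rewrite (Hconst s Is) in E1, E2, E3.
  assert (Hz : locally s (ex_derive z)).
  { generalize (HIo s Is). apply filter_imp. intros y Iy. apply (Cz y Iy). }
  rewrite <- (mean_curvature_normal c0 x z eta s 0 (e s0) Hz (N s Is) (HW s Is)).
  - rewrite Hm by exact Is. unfold dot. rewrite E3.
    unfold e3, crd1, crd2, crd3. simpl fst. simpl snd.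
    replace (fst (fst (eta s 0)) * 0 + snd (fst (eta s 0)) * 0 + e s0 * (x s * Derive x s / q s) * 1)
      with (e s0 * height c0 (x s) (Derive x s)) by (unfold height, q; ring).
    ring.
  - rewrite cos_0, sin_0, E1. unfold q. ring.
  - rewrite cos_0, sin_0, E2. unfold q. ring.
  - exact E3.
Qed.

Lemma is_derive_affine (f : R -> R) (a b k s0 s l : R) :
  is_derive f (s0 + b * s) l ->
  is_derive (fun y => a * f (s0 + b * y) + k) s (a * b * l).
Proof.
  intros Hf.
  replace (a * b * l) with (plus (a * scal b l) zero)
    by (unfold plus, zero, scal; simpl; unfold mult; simpl; ring).
  apply (is_derive_plus (V := R_NormedModule) (fun y => a * f (s0 + b * y)) (fun _ => k)).
  - apply (is_derive_scal (fun y => f (s0 + b * y))).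
    apply (is_derive_comp f (fun y => s0 + b * y)); auto. auto_derive; auto. ring.
  - apply (is_derive_const (V := R_NormedModule) k s).
Qed.

Lemma locally_affine (P : R -> Prop) (s0 b s : R) :
  locally (s0 + b * s) P -> locally s (fun y => P (s0 + b * y)).
Proof.
  intros H.
  assert (C : continuous (fun y => s0 + b * y) s).
  { apply (ex_derive_continuous (fun y => s0 + b * y)). auto_derive. auto. }
  exact (C P H).
Qed.

Lemma C2_at_affine (f : R -> R) (a b k s0 s : R) :
  locally (s0 + b * s) (C2_at f) ->
  let g := fun y => a * f (s0 + b * y) + k in
  C2_at g s /\ Derive g s = a * b * Derive f (s0 + b * s) /\
  Derive (Derive g) s = a * b * b * Derive (Derive f) (s0 + b * s).
Proof.
  intros H g.
  assert (L0 : locally s (fun y => C2_at f (s0 + b * y))) by (apply locally_affine; exact H).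
  assert (L1 : locally s (fun y => is_derive g y (a * b * Derive f (s0 + b * y)))).
  { revert L0. apply filter_imp. intros y (Y & _). apply is_derive_affine. apply Derive_correct. exact Y. }
  assert (L2 : locally s (fun y => Derive g y = a * b * Derive f (s0 + b * y) + 0)).
  { revert L1. apply filter_imp. intros y Y. rewrite (is_derive_unique _ _ _ Y). ring. }
  assert (L3 : locally s (fun y => is_derive (Derive g) y (a * b * b * Derive (Derive f) (s0 + b * y)))).
  { generalize (filter_and _ _ L0 (locally_locally _ _ L2)). apply filter_imp.
    intros y ((_ & Y & _) & Y').
    apply is_derive_ext_loc with (fun y => a * b * Derive f (s0 + b * y) + 0).
    - revert Y'. apply filter_imp. intros t ->. reflexivity.
    - apply is_derive_affine. apply Derive_correct. exact Y. }
  assert (L4 : locally s (fun y => a * b * b * Derive (Derive f) (s0 + b * y) = Derive (Derive g) y)).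
  { revert L3. apply filter_imp. intros y Y. symmetry. apply is_derive_unique. exact Y. }
  split; [split; [|split]|split].
  - eexists. apply (locally_singleton _ _ L1).
  - eexists. apply (locally_singleton _ _ L3).
  - apply continuous_ext_loc with (fun y => a * b * b * Derive (Derive f) (s0 + b * y)).
    + revert L4. apply filter_imp. auto.
    + apply (continuous_mult (K := R_AbsRing) (fun _ => a * b * b) (fun y => Derive (Derive f) (s0 + b * y))).
      * apply continuous_const.
      * apply (continuous_comp (fun y => s0 + b * y) (Derive (Derive f))).
        -- apply (ex_derive_continuous (fun y => s0 + b * y)). auto_derive. auto.
        -- apply (locally_singleton _ _ H).
  - rewrite (locally_singleton _ _ L2). ring.
  - symmetry. exact (locally_singleton _ _ L4).
Qed.

Lemma open_interval_affine (I : R -> Prop) (s0 b : R) :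
  b = 1 \/ b = -1 -> Defs.open_interval I -> Defs.open_interval (fun s => I (s0 + b * s)).
Proof.
  intros Hb (HI & (s & Is) & HC). split; [|split].
  - intros y Iy. apply locally_affine. apply HI. exact Iy.
  - exists (b * (s - s0)). destruct Hb as [->| ->];
      [replace (s0 + 1 * (1 * (s - s0))) with s by ring
      |replace (s0 + -1 * (-1 * (s - s0))) with s by ring]; exact Is.
  - intros p r t Hp Ht Hr. destruct Hb as [->| ->].
    + apply (HC (s0 + 1 * p) _ (s0 + 1 * t)); auto. lra.
    + apply (HC (s0 + -1 * t) _ (s0 + -1 * p)); auto. lra.
Qed.

Lemma solution_shift c0 h I x z k :
  solution c0 h I x z -> solution c0 h I x (fun s => z s + k).
Proof.
  intros (HI & S). split; auto. intros s Is.
  destruct (S s Is) as (Cx & Cz & N & Hx & Hode).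
  assert (L : locally (0 + 1 * s) (C2_at z)).
  { rewrite Rplus_0_l, Rmult_1_l. generalize (proj1 HI s Is). apply filter_imp.
    intros y Iy. apply (S y Iy). }
  destruct (C2_at_affine z 1 1 k 0 s L) as (A1 & A2 & A3). cbv zeta in *.
  assert (E : forall y, 1 * z (0 + 1 * y) + k = z y + k).
  { intros y. rewrite Rplus_0_l, !Rmult_1_l. reflexivity. }
  assert (B1 : Derive (fun y => z y + k) s = Derive z s).
  { rewrite <- (Derive_ext _ _ s E), A2, Rplus_0_l, !Rmult_1_l. reflexivity. }
  assert (B2 : Derive (Derive (fun y => z y + k)) s = Derive (Derive z) s).
  { rewrite <- (Derive_ext _ _ s (fun y => Derive_ext _ _ y E)), A3, Rplus_0_l, !Rmult_1_l. reflexivity. }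
  unfold profile_at, curv. rewrite B1, B2. split; [|split; [|split; [|split]]]; auto.
  apply C2_at_ext with (2 := A1). apply filter_forall. exact E.
Qed.

(** Reversing the profile changes the sign of the reference normal, and so can
    make the orientation sign positive; reflecting it to [- x] then makes the curve
    leave the axis towards positive [x]. The reflected profile generates the
    same surface after half a turn, that is, after a vertical translation by
    [c0 * PI]; the constant [k] records it together with the crossing height. *)
Lemma normal_form c0 h Sigma :
  c0 <> 0 -> helicoidal_H_surface (fun v => h (dot v e3)) c0 Sigma -> meets_axis Sigma ->
  exists I x z k, solution c0 h I x z /\ axial_start I x z /\
    forall p, Sigma p <-> orbit c0 I x (fun s => z s + k) p.
Proof.
  intros Hc (I & x & z & eta & HI & Hp & Hg & Hm & HS) (t0 & Ht0).
  destruct (surface_equation c0 h I x z eta Hc HI Hp Hg Hm) as (b & Hb & Hode).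
  apply HS in Ht0. destruct Ht0 as (s0 & th & Is0 & Heq).
  assert (Hx0 : x s0 = 0).
  { unfold helicoidal_param in Heq. injection Heq as E1 E2 _.
    pose proof (sin2_cos2 th) as T. unfold Rsqr in T.
    replace (x s0) with (x s0 * (sin th * sin th + cos th * cos th)) by (rewrite T; ring).
    replace (x s0 * (sin th * sin th + cos th * cos th))
      with (x s0 * sin th * sin th + x s0 * cos th * cos th) by ring.
    rewrite <- E1, <- E2. ring. }
  destruct Hp as (Cx & Cz & N & Hx).
  assert (Hu0 : Derive x s0 <> 0) by auto.
  assert (Ha : exists a, (a = 1 \/ a = -1) /\ 0 < a * b * Derive x s0).
  { destruct (Rdichotomy _ _ Hu0); destruct Hb as [->| ->];
      [exists (-1) | exists 1 | exists 1 | exists (-1)]; lra. }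
  destruct Ha as (a & Ha & Hpos).
  assert (Hbb : b * b = 1) by (destruct Hb as [->| ->]; ring).
  assert (Haa : a * a = 1) by (destruct Ha as [->| ->]; ring).
  set (J := fun s => I (s0 + b * s)).
  set (X := fun s => a * x (s0 + b * s) + 0).
  set (Z := fun s => 1 * z (s0 + b * s) + - z s0).
  assert (LX : forall s, J s -> C2_at X s /\ Derive X s = a * b * Derive x (s0 + b * s) /\
            Derive (Derive X) s = a * b * b * Derive (Derive x) (s0 + b * s)).
  { intros s Js. apply C2_at_affine. generalize (proj1 HI _ Js). apply filter_imp. exact Cx. }
  assert (LZ : forall s, J s -> C2_at Z s /\ Derive Z s = 1 * b * Derive z (s0 + b * s) /\
            Derive (Derive Z) s = 1 * b * b * Derive (Derive z) (s0 + b * s)).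
  { intros s Js. apply C2_at_affine. generalize (proj1 HI _ Js). apply filter_imp. exact Cz. }
  assert (E0 : s0 + b * 0 = s0) by ring.
  assert (J0 : J 0) by (unfold J; rewrite E0; exact Is0).
  assert (SJ : solution c0 h J X Z).
  { split; [apply open_interval_affine; auto|]. intros s Js.
    destruct (LX s Js) as (X0 & X1 & X2). destruct (LZ s Js) as (Z0 & Z1 & Z2).
    assert (Hod := Hode _ Js). assert (Nt := N _ Js). assert (Hxt := Hx _ Js).
    assert (EX : X s = a * x (s0 + b * s)) by (unfold X; ring).
    split; [|split; [|split; [|split]]]; auto.
    - apply eq_trans with (2 := Nt). rewrite X1, Z1. set (u := Derive x (s0 + b * s)). set (v := Derive z (s0 + b * s)).
      replace ((a * b * u) ^ 2 + (1 * b * v) ^ 2) with (a * a * (b * b) * u ^ 2 + b * b * v ^ 2) by ring.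
      rewrite Haa, Hbb. ring.
    - rewrite EX, X1. intros K. assert (a <> 0) by (destruct Ha; lra). assert (b <> 0) by (destruct Hb; lra).
      apply Rmult_integral in K. destruct K as [K|K]; [contradiction|].
      repeat apply Rmult_integral_contrapositive_currified; auto.
    - unfold bending, curv in *. rewrite X2, Z2, X1, Z1, EX.
      set (u := Derive x (s0 + b * s)) in *. set (v := Derive z (s0 + b * s)) in *.
      set (p := Derive (Derive x) (s0 + b * s)) in *. set (r := Derive (Derive z) (s0 + b * s)) in *.
      set (y := x (s0 + b * s)) in *.
      assert (EW : area2 c0 (a * y) (a * b * u) = area2 c0 y u).
      { unfold area2. replace (c0 ^ 2 * (a * b * u) ^ 2 + (a * y) ^ 2)
          with (a * a * (b * b) * (c0 ^ 2 * u ^ 2) + a * a * y ^ 2) by ring.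
        rewrite Haa, Hbb. ring. }
      assert (EH : height c0 (a * y) (a * b * u) = b * height c0 y u).
      { unfold height. rewrite EW. replace (a * y * (a * b * u)) with (a * a * (b * (y * u))) by ring.
        rewrite Haa. unfold Rdiv. ring. }
      rewrite EW, EH, <- Hod.
      replace ((a * b * u * (1 * b * b * r) - 1 * b * v * (a * b * b * p)) * (a * y * ((a * y) ^ 2 + c0 ^ 2)))
        with (b * (a * a * (b * b)) * (u * r - v * p) * (y * (a * a * y ^ 2 + c0 ^ 2))) by ring.
      replace ((a * b * u) ^ 2) with (a * a * (b * b) * u ^ 2) by ring.
      replace ((a * y) ^ 2) with (a * a * y ^ 2) by ring.
      rewrite Haa, Hbb. ring. }
  assert (HAx : axial_start J X Z).
  { split; [exact J0|]. split; [|split].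
    - unfold X. rewrite E0, Hx0. ring.
    - destruct (LX 0 J0) as (_ & -> & _). rewrite E0. exact Hpos.
    - unfold Z. rewrite E0. ring. }
  assert (Hrep : forall s, exists r, s0 + b * r = s).
  { intros s. exists (b * (s - s0)). replace (s0 + b * (b * (s - s0))) with (s0 + b * b * (s - s0)) by ring.
    rewrite Hbb. ring. }
  exists J, X, Z.
  destruct Ha as [Ha|Ha].
  - exists (z s0). split; [auto|]. split; [auto|]. intros p. rewrite HS. unfold orbit. split.
    + intros (s & t & Is & ->). destruct (Hrep s) as (r & <-).
      exists r, t. split; [exact Is|]. unfold helicoidal_param, X, Z. rewrite Ha.
      f_equal; [f_equal|]; ring.
    + intros (s & t & Js & ->). exists (s0 + b * s), t. split; [exact Js|].
      unfold helicoidal_param, X, Z. rewrite Ha. f_equal; [f_equal|]; ring.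
  - exists (z s0 - c0 * PI). split; [auto|]. split; [auto|]. intros p. rewrite HS. unfold orbit. split.
    + intros (s & t & Is & ->). destruct (Hrep s) as (r & <-).
      exists r, (t + PI). split; [exact Is|]. unfold helicoidal_param, X, Z.
      rewrite neg_cos, neg_sin, Ha. f_equal; [f_equal|]; ring.
    + intros (s & t & Js & ->). exists (s0 + b * s), (t - PI). split; [exact Js|].
      assert (Ec := neg_cos (t - PI)). assert (Es := neg_sin (t - PI)).
      replace (t - PI + PI) with t in Ec, Es by ring.
      unfold helicoidal_param, X, Z.
      rewrite Ec, Es, Ha. f_equal; [f_equal|]; ring.
Qed.

(** Rotating the surface amounts to translating the profile vertically. *)
Lemma rot_helicoidal c0 x z phi s t :
  rot_e3 phi (helicoidal_param c0 x z s t) =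
  helicoidal_param c0 x (fun y => z y + - c0 * phi) s (t + phi).
Proof.
  unfold rot_e3, helicoidal_param, crd1, crd2, crd3. simpl fst. simpl snd.
  rewrite cos_plus, sin_plus. f_equal; [f_equal|]; ring.
Qed.

(** * Uniqueness up to rotation *)

Theorem proposition2p4 (c0 : R) (hc0 : c0 <> 0) (h : R -> R) (hh : C1_m1_1 h)
  (Sigma1 Sigma2 : R3 -> Prop) :
  let H := fun v : R3 => h (dot v e3) in
  helicoidal_H_surface H c0 Sigma1 -> inextendible H c0 Sigma1 -> meets_axis Sigma1 ->
  helicoidal_H_surface H c0 Sigma2 -> inextendible H c0 Sigma2 -> meets_axis Sigma2 ->
  exists phi : R, forall p : R3,
    Sigma2 p <-> exists q : R3, Sigma1 q /\ p = rot_e3 phi q.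
Proof.
  intros H S1 M1 A1 S2 M2 A2.
  destruct (normal_form c0 h Sigma1 hc0 S1 A1) as (I1 & x1 & z1 & k1 & Sol1 & Ax1 & O1).
  destruct (normal_form c0 h Sigma2 hc0 S2 A2) as (I2 & x2 & z2 & k2 & Sol2 & Ax2 & O2).
  assert (Hag := solutions_agree c0 h I1 x1 z1 I2 x2 z2 hc0 hh Sol1 Ax1 Sol2 Ax2).
  set (I := fun s => I1 s \/ I2 s).
  set (x := glue I1 x1 x2). set (z := glue I1 z1 z2).
  assert (Sol : solution c0 h I x z).
  { apply (solution_glue c0 h I1 x1 z1 I2 x2 z2 0); auto; [apply Ax1|apply Ax2]. }
  assert (Surf : forall k, helicoidal_H_surface H c0 (orbit c0 I x (fun s => z s + k))).
  { intros k. apply solution_surface; auto. apply solution_shift. exact Sol. }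
  assert (E1 : forall p, Sigma1 p <-> orbit c0 I x (fun s => z s + k1) p).
  { assert (L : forall p, Sigma1 p -> orbit c0 I x (fun s => z s + k1) p).
    { intros p Hp. apply O1 in Hp. destruct Hp as (s & t & Is & ->).
      exists s, t. split; [left; exact Is|]. unfold helicoidal_param, x, z.
      rewrite !glue_left by exact Is. reflexivity. }
    split; [apply L|]. apply (M1 _ (Surf k1) L). }
  assert (E2 : forall p, Sigma2 p <-> orbit c0 I x (fun s => z s + k2) p).
  { assert (L : forall p, Sigma2 p -> orbit c0 I x (fun s => z s + k2) p).
    { intros p Hp. apply O2 in Hp. destruct Hp as (s & t & Is & ->).
      exists s, t. split; [right; exact Is|]. unfold helicoidal_param, x, z.
      rewrite (glue_right I1 I2 x1 x2), (glue_right I1 I2 z1 z2); auto; intros; apply Hag; auto. }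
    split; [apply L|]. apply (M2 _ (Surf k2) L). }
  exists ((k1 - k2) / c0). intros p. rewrite E2. split.
  - intros (s & t & Is & ->).
    exists (helicoidal_param c0 x (fun s => z s + k1) s (t - (k1 - k2) / c0)). split.
    + apply E1. exists s, (t - (k1 - k2) / c0). auto.
    + rewrite rot_helicoidal. unfold helicoidal_param.
      replace (t - (k1 - k2) / c0 + (k1 - k2) / c0) with t by ring.
      f_equal. field. exact hc0.
  - intros (q & Hq & ->). apply E1 in Hq. destruct Hq as (s & t & Is & ->).
    exists s, (t + (k1 - k2) / c0). split; auto.
    rewrite rot_helicoidal. unfold helicoidal_param. f_equal. field. exact hc0.
Qed.
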